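(* Let $u:\mathfrak{g}_\lambda\to\mathfrak{g}_\lambda$ be a $\mathbf{k}_\lambda$-symmetric linear isomorphism such that $u(e_0)=e_0$ and, for each $1\le i\le n$, $u(e_i)=\eta_i e_i$ and $u(\check e_i)=\check\eta_i\check e_i$, where for each $i$ between $1$ and $n$ one has either (a) $\eta_i+\check\eta_i=1$ or (b) $\eta_i=\check\eta_i$ (which of the two holds may depend on $i$). Then, for every $\lambda$, the left-invariant pseudo-Riemannian metric $\mathbf{k}_u$ on $G_\lambda$ is locally symmetric and geodesically complete, hence symmetric.
   Context: Let $n\ge 1$ and $\lambda=(\lambda_1,\ldots,\lambda_n)\in\mathbb{R}^n$ with $0<\lambda_1\le\cdots\le\lambda_n$. The oscillator group $G_\lambda$ is the simply connected Lie group with underlying manifold $\mathbb{R}\times\mathbb{R}\times\mathbb{C}^n$ and product $$(t,s,z_1,\ldots,z_n)\cdot(t',s',z'_1,\ldots,z'_n)=\Big(t+t',\,s+s'+\tfrac12\sum_{j=1}^n\mathrm{Im}(\bar z_j e^{it\lambda_j}z'_j),\,\ldots,z_j+e^{it\lambda_j}z'_j,\ldots\Big).$$ Its Lie algebra $\mathfrak{g}_\lambda$ has basis $e_{-1},e_0,e_1,\ldots,e_n,\check e_1,\ldots,\check e_n$ with brackets $[e_{-1},e_j]=\lambda_j\check e_j$, $[e_j,\check e_j]=e_0$, $[e_{-1},\check e_j]=-\lambda_j e_j$, the other brackets being zero or deduced by antisymmetry. For $x=\sum_{j=-1}^n x_je_j+\sum_{j=1}^n\check x_j\check e_j$, the nondegenerate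 ad-invariant symmetric bilinear form $\mathbf{k}_\lambda$ is given by $\mathbf{k}_\lambda(x,x)=2x_{-1}x_0+\sum_{j=1}^n\frac1{\lambda_j}(x_j^2+\check x_j^2)$. A linear isomorphism $u$ of $\mathfrak{g}_\lambda$ is $\mathbf{k}_\lambda$-symmetric if $\mathbf{k}_\lambda(u(x),y)=\mathbf{k}_\lambda(x,u(y))$ for all $x,y$; then $\mathbf{k}_u$ denotes the left-invariant pseudo-Riemannian metric on $G_\lambda$ whose value at the identity is $\mathbf{k}_u(x,y)=\mathbf{k}_\lambda(u(x),y)$. Locally symmetric means that the curvature tensor is parallel for the Levi-Civita connection; symmetric means pseudo-Riemannian globally symmetric. *)

(* Defs.v *)
From HB Require Import structures.
From mathcomp Require Import all_boot all_order all_algebra.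
From mathcomp Require Import complex.
From mathcomp Require Import ring lra.
From mathcomp Require Import all_classical all_reals all_analysis.

Set Implicit Arguments.
Unset Strict Implicit.
Unset Printing Implicit Defensive.

Import Order.TTheory GRing.Theory Num.Theory.
Import numFieldNormedType.Exports.
Local Open Scope ring_scope.

(** * Pseudo-Riemannian geometry in one global chart

   The manifold is a finite-dimensional real vector space [V], each tangent
   space is identified with [V], and a metric is a field of bilinear forms
   [g p v w].  A connection is given by its Christoffel symbols: for vector
   fields [X], [Y],
     (nabla_X Y)(p) = 'D_(X p) Y p + Gam p (X p) (Y p).
   All the tensors below are evaluated on constant vector fields, which commute
   with each other. *)

Definition smooth (R : realType) (V W : normedModType R) (f : V -> W) : Prop :=
  forall (vs : seq V) (p : V),
    differentiable (foldr (fun v h => fun q => 'D_v h q) f vs) p.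

Definition pseudo_riemannian (R : realType) (V : normedModType R)
    (g : V -> V -> V -> R) : Prop :=
  [/\ forall v w, smooth (fun p => g p v w),
      forall p v w, g p v w = g p w v,
      forall p a v v' w, g p (a *: v + v') w = a * g p v w + g p v' w &
      forall p v, (forall w, g p v w = 0) -> v = 0].

(* Torsion-free and metric; unique by [levi_civita_unique], and bilinear. *)
Definition is_levi_civita (R : realType) (V : normedModType R)
    (g : V -> V -> V -> R) (Gam : V -> V -> V -> V) : Prop :=
  (forall p v w, Gam p v w = Gam p w v) /\
  (forall p a v w,
     'D_a (fun q => g q v w) p = g p (Gam p a v) w + g p v (Gam p a w)).

Lemma levi_civita_unique (R : realType) (V : normedModType R)
    (g : V -> V -> V -> R) (G1 G2 : V -> V -> V -> V) :
  pseudo_riemannian g -> is_levi_civita g G1 -> is_levi_civita g G2 ->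
  forall p v w, G1 p v w = G2 p v w.
Proof.
move=> [_ gC gL g0] [T1 M1] [T2 M2] p v w.
have gB x y z : g p (x - y) z = g p x z - g p y z.
  by rewrite addrC -scaleN1r gL mulN1r addrC.
pose B x y z := g p (G1 p x y - G2 p x y) z.
have BC x y z : B x y z = B y x z by rewrite /B T1 T2.
have BN x y z : B x y z = - B x z y.
  have := M1 p x y z; rewrite M2 (gC p y) (gC p y (G1 _ _ _)) /B !gB => h.
  by lra.
apply/eqP; rewrite -subr_eq0; apply/eqP; apply: (g0 p) => z.
change (B v w z = 0).
have : B v w z = - B v w z.
  by rewrite {1}BN BC BN BC BN opprK BC.
by move: (B v w z) => b h; lra.
Qed.

(* R(v, w) z = nabla_v nabla_w z - nabla_w nabla_v z *)
Definition curvature (R : realType) (V : normedModType R)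
    (Gam : V -> V -> V -> V) (p v w z : V) : V :=
  'D_v (fun q => Gam q w z) p - 'D_w (fun q => Gam q v z) p
  + Gam p v (Gam p w z) - Gam p w (Gam p v z).

(* (nabla_a R)(v, w) z *)
Definition nabla_curvature (R : realType) (V : normedModType R)
    (Gam : V -> V -> V -> V) (p a v w z : V) : V :=
  'D_a (fun q => curvature Gam q v w z) p
  + Gam p a (curvature Gam p v w z)
  - curvature Gam p (Gam p a v) w z
  - curvature Gam p v (Gam p a w) z
  - curvature Gam p v w (Gam p a z).

Definition locally_symmetric (R : realType) (V : normedModType R)
    (g : V -> V -> V -> R) : Prop :=
  exists Gam, is_levi_civita g Gam /\
    forall p a v w z, nabla_curvature Gam p a v w z = 0.

Definition is_geodesic (R : realType) (V : normedModType R)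
    (Gam : V -> V -> V -> V) (c : R -> V) : Prop :=
  forall t : R, [/\ derivable c t 1, derivable (derive1 c) t 1 &
    derive1 (derive1 c) t + Gam (c t) (derive1 c t) (derive1 c t) = 0].

(* The exponential map is defined on the whole tangent bundle. *)
Definition geodesically_complete (R : realType) (V : normedModType R)
    (g : V -> V -> V -> R) : Prop :=
  exists Gam, is_levi_civita g Gam /\
    forall p v, exists c : R -> V,
      [/\ is_geodesic Gam c, c 0 = p & derive1 c 0 = v].

Definition is_isometry (R : realType) (V : normedModType R)
    (g : V -> V -> V -> R) (phi : V -> V) : Prop :=
  [/\ smooth phi,
      exists psi, [/\ smooth psi, cancel phi psi & cancel psi phi] &
      forall p v w, g (phi p) ('d phi p v) ('d phi p w) = g p v w].

(* The connectedness of a symmetric space is automatic, [V] being a vector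
   space. *)
Definition symmetric_space (R : realType) (V : normedModType R)
    (g : V -> V -> V -> R) : Prop :=
  pseudo_riemannian g /\
  forall p, exists sigma : V -> V,
    [/\ is_isometry g sigma, sigma p = p & forall v, 'd sigma p v = - v].

(** * Oscillator groups *)

(* The point ((t, s), (x, y)) stands for (t, s, x_1 + i y_1, ..., x_n + i y_n).
   The same type is the Lie algebra, i.e. the tangent space at the unit. *)
Definition osc (R : realType) (n : nat) : normedModType R :=
  ((R * R) * ('rV[R]_n * 'rV[R]_n))%type.

Definition osc_t (R : realType) (n : nat) (p : osc R n) : R := p.1.1.
Definition osc_s (R : realType) (n : nat) (p : osc R n) : R := p.1.2.
Definition osc_x (R : realType) (n : nat) (p : osc R n) (j : 'I_n) : R :=
  p.2.1 0 j.
Definition osc_y (R : realType) (n : nat) (p : osc R n) (j : 'I_n) : R :=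
  p.2.2 0 j.
Definition osc_z (R : realType) (n : nat) (p : osc R n) (j : 'I_n) : R[i] :=
  Complex (osc_x p j) (osc_y p j).

(* e^{i theta} *)
Definition expi (R : realType) (theta : R) : R[i] :=
  Complex (cos theta) (sin theta).

Definition osc_mk (R : realType) (n : nat) (t s : R) (z : 'I_n -> R[i]) :
    osc R n :=
  ((t, s), (\row_j complex.Re (z j), \row_j complex.Im (z j))).

Definition osc_mul (R : realType) (n : nat) (lam : 'I_n -> R) (p q : osc R n) :
    osc R n :=
  osc_mk (osc_t p + osc_t q)
    (osc_s p + osc_s q
     + 2^-1 * \sum_j complex.Im
         (conjc (osc_z p j) * expi (osc_t p * lam j) * osc_z q j))
    (fun j => osc_z p j + expi (osc_t p * lam j) * osc_z q j).

Definition osc_inv (R : realType) (n : nat) (lam : 'I_n -> R) (p : osc R n) :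
    osc R n :=
  osc_mk (- osc_t p) (- osc_s p)
    (fun j => - (expi (- (osc_t p * lam j)) * osc_z p j)).

(* e_{-1}, e_0, e_j and \check e_j *)
Definition osc_em1 (R : realType) (n : nat) : osc R n := ((1, 0), (0, 0)).
Definition osc_e0 (R : realType) (n : nat) : osc R n := ((0, 1), (0, 0)).
Definition osc_e (R : realType) (n : nat) (j : 'I_n) : osc R n :=
  ((0, 0), (delta_mx 0 j, 0)).
Definition osc_ec (R : realType) (n : nat) (j : 'I_n) : osc R n :=
  ((0, 0), (0, delta_mx 0 j)).

(* Value at the unit of the commutator of the left-invariant vector fields
   extending v and w. *)
Definition osc_bracket (R : realType) (n : nat) (lam : 'I_n -> R)
    (v w : osc R n) : osc R n :=
  'D_v (fun p => 'd (osc_mul lam p) 0 w) 0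
  - 'D_w (fun p => 'd (osc_mul lam p) 0 v) 0.

Lemma expiD (R : realType) (a b : R) : expi (a + b) = expi a * expi b.
Proof. by rewrite /expi cosD sinD; apply/eqP; rewrite eq_complex /= eqxx [X in _ == X]addrC eqxx. Qed.

Lemma osc_eqP (R : realType) (n : nat) (p q : osc R n) :
  osc_t p = osc_t q -> osc_s p = osc_s q -> (forall j, osc_z p j = osc_z q j) ->
  p = q.
Proof.
case: p q => [[t s] [x y]] [[t' s'] [x' y']]; rewrite /osc_t /osc_s /= => -> -> h.
by congr (_, (_, _)); apply/rowP => j; have [] := h j.
Qed.

Lemma osc_z_mk (R : realType) (n : nat) (t s : R) (z : 'I_n -> R[i]) j :
  osc_z (osc_mk t s z) j = z j.
Proof. by rewrite /osc_z /osc_x /osc_y /= !mxE; case: (z j). Qed.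

Lemma osc_s_mul (R : realType) (n : nat) (lam : 'I_n -> R) (p q : osc R n) :
  osc_s (osc_mul lam p q) = osc_s p + osc_s q
     + 2^-1 * \sum_j complex.Im
         (conjc (osc_z p j) * expi (osc_t p * lam j) * osc_z q j).
Proof. by []. Qed.

Lemma osc_z_mul (R : realType) (n : nat) (lam : 'I_n -> R) (p q : osc R n) j :
  osc_z (osc_mul lam p q) j = osc_z p j + expi (osc_t p * lam j) * osc_z q j.
Proof. exact: osc_z_mk. Qed.

Lemma osc_mulVp (R : realType) (n : nat) (lam : 'I_n -> R) (p : osc R n) :
  osc_mul lam (osc_inv lam p) p = 0.
Proof.
apply: osc_eqP => [||j].
- by rewrite /osc_t /= addNr.
- rewrite osc_s_mul [osc_s _ + _]addNr add0r big1 ?mulr0 // => j _.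
  rewrite osc_z_mk {2}/osc_t [X in X * _]/= mulNr.
  by rewrite /osc_z /=; ring.
- rewrite osc_z_mul osc_z_mk {2}/osc_t [X in X * lam j]/= mulNr addNr.
  by rewrite /osc_z /osc_x /osc_y /= !mxE.
Qed.

Lemma osc_mulA (R : realType) (n : nat) (lam : 'I_n -> R) :
  associative (osc_mul lam).
Proof.
move=> p q r; apply: osc_eqP => [||j].
- exact: addrA.
- rewrite !osc_s_mul -!addrA; congr (_ + (_ + _)).
  rewrite [RHS]addrCA; congr (_ + _).
  rewrite -!mulrDr -!big_split; congr (_ * _); apply: eq_bigr => j _.
  rewrite !osc_z_mul -[osc_t (osc_mul _ _ _)]/(_ + _) mulrDl expiD /osc_z /=.
  have := cos2Dsin2 (osc_t p * lam j).
  set c := cos (osc_t p * _); set d := sin (osc_t p * _) => h.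
  have {}h : d ^+ 2 = 1 - c ^+ 2 by rewrite -h; ring.
  by ring: h.
- rewrite !osc_z_mul -[osc_t (osc_mul _ _ _)]/(_ + _) mulrDl expiD; ring.
Qed.

(* The polar form of the quadratic form in [kform_diag]. *)
Definition kform (R : realType) (n : nat) (lam : 'I_n -> R) (v w : osc R n) : R :=
  osc_t v * osc_s w + osc_s v * osc_t w
  + \sum_j (lam j)^-1 * (osc_x v j * osc_x w j + osc_y v j * osc_y w j).

Lemma kform_diag (R : realType) (n : nat) (lam : 'I_n -> R) (v : osc R n) :
  kform lam v v = 2 * osc_t v * osc_s v
    + \sum_j (lam j)^-1 * (osc_x v j ^+ 2 + osc_y v j ^+ 2).
Proof. by rewrite /kform; congr (_ + _); ring. Qed.

Definition kform_symmetric (R : realType) (n : nat) (lam : 'I_n -> R)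
    (u : osc R n -> osc R n) : Prop :=
  forall v w, kform lam (u v) w = kform lam v (u w).

(* The left-invariant metric with value kform (u v) w at the unit: tangent
   vectors at p are translated to the unit by the differential of the left
   translation by p^-1. *)
Definition kmetric (R : realType) (n : nat) (lam : 'I_n -> R)
    (u : osc R n -> osc R n) (p v w : osc R n) : R :=
  kform lam (u ('d (osc_mul lam (osc_inv lam p)) p v))
            ('d (osc_mul lam (osc_inv lam p)) p w).

Lemma osc_basis_sum (R : realType) (n : nat) (p : osc R n) :
  p = osc_t p *: osc_em1 R n + osc_s p *: osc_e0 R n
      + \sum_j osc_x p j *: osc_e R j + \sum_j osc_y p j *: osc_ec R j.
Proof.
have S2 I (F : I -> osc R n) (r : seq I) :
    \sum_(i <- r) F i = ((\sum_(i <- r) (F i).1.1, \sum_(i <- r) (F i).1.2),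
                         (\sum_(i <- r) (F i).2.1, \sum_(i <- r) (F i).2.2)).
  elim: r => [|i r IH]; first by rewrite !big_nil.
  by rewrite !big_cons IH; case: (F i) => [[? ?] [? ?]].
case: p => [[t s] [x y]]; rewrite /osc_t /osc_s !S2 /=.
congr (_, _); congr (_, _); rewrite /= ?scaler0 ?addr0 ?add0r.
- by rewrite !big1 ?addr0 => [|* |*]; rewrite ?scaler0 // [RHS]mulr1.
- by rewrite !big1 ?addr0 => [|* |*]; rewrite ?scaler0 // [RHS]mulr1.
- rewrite [X in _ = _ + X]big1 ?addr0; last by move=> *; rewrite scaler0.
  exact: row_sum_delta.
- rewrite [X in _ = X + _]big1 ?add0r; last by move=> *; rewrite scaler0.
  exact: row_sum_delta.
Qed.

Lemma osc_linear_continuous (R : realType) (n : nat) (W : normedModType R)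
  (L : {linear osc R n -> W}) : continuous L.
Proof.
have ct : continuous (@osc_t R n).
  by move=> p; apply: continuous_comp; [exact: cvg_fst|exact: cvg_fst].
have cs : continuous (@osc_s R n).
  by move=> p; apply: continuous_comp; [exact: cvg_fst|exact: cvg_snd].
have cx j : continuous (fun p : osc R n => osc_x p j).
  move=> p; apply: (@continuous_comp _ _ _ (fun p : osc R n => p.2.1) (fun M : 'rV[R]_n => M 0 j)).
    by apply: continuous_comp; [exact: cvg_snd|exact: cvg_fst].
  exact: coord_continuous.
have cy j : continuous (fun p : osc R n => osc_y p j).
  move=> p; apply: (@continuous_comp _ _ _ (fun p : osc R n => p.2.2) (fun M : 'rV[R]_n => M 0 j)).
    by apply: continuous_comp; [exact: cvg_snd|exact: cvg_snd].
  exact: coord_continuous.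
have Z (f : osc R n -> R) (w : W) : continuous f -> continuous (fun p => f p *: w).
  move=> cf p; apply: (@continuous_comp _ _ _ f (fun k => k *: w)); first exact: cf.
  exact: scalel_continuous.
have S (r : seq 'I_n) (f : 'I_n -> osc R n -> W) :
  (forall j, continuous (f j)) -> continuous (fun p => \sum_(j <- r) f j p).
  move=> cf; elim: r => [|i r IH].
    rewrite (_ : (fun _ => _) = cst 0); first exact: cst_continuous.
    by apply/funext => p; rewrite big_nil.
  rewrite (_ : (fun _ => _) = fun p => f i p + \sum_(j <- r) f j p).
    by move=> p; apply: continuousD; [exact: cf|exact: IH].
  by apply/funext => p; rewrite big_cons.
rewrite (_ : (L : _ -> _) = fun p => osc_t p *: L (osc_em1 R n) + osc_s p *: L (osc_e0 R n)
      + \sum_j osc_x p j *: L (osc_e R j) + \sum_j osc_y p j *: L (osc_ec R j)).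
  move=> p; apply: (@continuousD _ _ _ (fun p => _ + _) (fun p => \sum_j _)).
    apply: (@continuousD _ _ _ (fun p => _ + _) (fun p => \sum_j _)).
      by apply: continuousD; exact: Z.
    by apply: S => j; apply: Z.
  by apply: S => j; apply: Z.
apply/funext => p; rewrite {1}(osc_basis_sum p) !linearD !linear_sum !linearZ /=.
by congr (_ + _ + _ + _); apply: eq_bigr => j _; rewrite linearZ.
Qed.

Lemma diff_affine (R : realType) (V W : normedModType R) (f : V -> W) (c : W)
    (L : {linear V -> W}) (p v : V) :
  continuous L -> (forall w, f w = c + L w) -> 'd f p v = L v.
Proof.
move=> Lc fE; have -> : f = cst c + (L : V -> W) by apply/funext.
have dL : differentiable L p by exact: linear_differentiable.
by rewrite diffD // diff_cst diff_lin // [LHS]add0r.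
Qed.

(* The differential of the left translation by [p], at any point. *)
Definition osc_dmul (R : realType) (n : nat) (lam : 'I_n -> R) (p v : osc R n) :
    osc R n :=
  osc_mk (osc_t v)
    (osc_s v + 2^-1 * \sum_j complex.Im
         (conjc (osc_z p j) * expi (osc_t p * lam j) * osc_z v j))
    (fun j => expi (osc_t p * lam j) * osc_z v j).

Lemma osc_zD (R : realType) (n : nat) (v w : osc R n) j :
  osc_z (v + w) j = osc_z v j + osc_z w j.
Proof. by rewrite /osc_z /osc_x /osc_y /= !mxE. Qed.

Lemma osc_zZ (R : realType) (n : nat) a (v : osc R n) j :
  osc_z (a *: v) j = a%:C%C * osc_z v j.
Proof. by rewrite /osc_z /osc_x /osc_y /= !mxE; apply/eqP; rewrite eq_complex /= !mul0r subr0 addr0 !eqxx. Qed.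

Lemma osc_dmul_linear (R : realType) (n : nat) (lam : 'I_n -> R) (p : osc R n) :
  linear (osc_dmul lam p).
Proof.
move=> a v w; apply: osc_eqP => [||j].
- by [].
- rewrite -[LHS]/(_ + _ * _) -[RHS]/(a * (_ + _ * _) + (_ + _ * _)).
  rewrite -[osc_s (a *: v + w)]/(a * osc_s v + osc_s w).
  rewrite [in RHS]mulrDr [RHS]addrACA; congr (_ + _).
  rewrite mulrCA -mulrDr [a * _]mulr_sumr -big_split; congr (_ * _).
  apply: eq_bigr => j _.
  by rewrite osc_zD osc_zZ /osc_z /=; ring.
- by rewrite osc_zD osc_zZ !osc_z_mk osc_zD osc_zZ; ring.
Qed.

Lemma diff_osc_mul (R : realType) (n : nat) (lam : 'I_n -> R) (p q v : osc R n) :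
  'd (osc_mul lam p) q v = osc_dmul lam p v.
Proof.
pose M := GRing.isLinear.Build _ _ _ _ _ (osc_dmul_linear lam p).
pose L : {linear osc R n -> osc R n} := HB.pack (osc_dmul lam p) M.
have Lc : continuous L by exact: osc_linear_continuous.
apply: (@diff_affine _ _ _ _ p L q v Lc) => w; apply: osc_eqP => [//||j].
  by rewrite osc_s_mul -addrA.
by rewrite osc_z_mul osc_zD osc_z_mk.
Qed.

Lemma osc_dmulM (R : realType) (n : nat) (lam : 'I_n -> R) (p q v : osc R n) :
  osc_dmul lam (osc_mul lam p q) v = osc_dmul lam p (osc_dmul lam q v).
Proof.
apply: osc_eqP => [//||j].
- rewrite -[LHS]/(_ + _ * _) -[RHS]/(_ + _ * _ + _ * _) -addrA.
  congr (_ + _); rewrite -mulrDr -big_split; congr (_ * _).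
  apply: eq_bigr => j _; rewrite osc_z_mul osc_z_mk.
  rewrite -[osc_t (osc_mul _ _ _)]/(_ + _) mulrDl expiD /osc_z /=.
  have := cos2Dsin2 (osc_t p * lam j).
  set c := cos (osc_t p * _); set d := sin (osc_t p * _) => h.
  have {}h : d ^+ 2 = 1 - c ^+ 2 by rewrite -h; ring.
  by ring: h.
- rewrite !osc_z_mk -[osc_t (osc_mul _ _ _)]/(_ + _) mulrDl expiD; ring.
Qed.

Lemma expi0 (R : realType) : expi 0 = 1 :> R[i].
Proof. by rewrite /expi cos0 sin0. Qed.

Lemma osc_z0 (R : realType) (n : nat) j : osc_z (0 : osc R n) j = 0.
Proof. by rewrite /osc_z /osc_x /osc_y /= !mxE. Qed.

Lemma osc_mulp0 (R : realType) (n : nat) (lam : 'I_n -> R) :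
  right_id 0 (osc_mul lam).
Proof.
move=> p; apply: osc_eqP => [||j].
- exact: addr0.
- rewrite osc_s_mul [osc_s p + _]addr0 big1 ?mulr0 ?addr0 // => j _.
  by rewrite osc_z0 mulr0.
- by rewrite osc_z_mul osc_z0 mulr0 addr0.
Qed.

Lemma osc_mul0p (R : realType) (n : nat) (lam : 'I_n -> R) :
  left_id 0 (osc_mul lam).
Proof.
move=> p; apply: osc_eqP => [||j].
- exact: add0r.
- rewrite osc_s_mul [_ + osc_s p]add0r big1 ?mulr0 ?addr0 // => j _.
  by rewrite osc_z0 rmorph0 !mul0r.
- by rewrite osc_z_mul osc_z0 [osc_t 0 * _]mul0r expi0 add0r mul1r.
Qed.

Lemma osc_mulpV (R : realType) (n : nat) (lam : 'I_n -> R) (p : osc R n) :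
  osc_mul lam p (osc_inv lam p) = 0.
Proof.
set q := osc_inv lam p; rewrite -[LHS](osc_mul0p lam).
rewrite -{1}(osc_mulVp lam q) -osc_mulA (osc_mulA lam q p) osc_mulVp.
by rewrite osc_mul0p osc_mulVp.
Qed.

Lemma diff_osc_mulE (R : realType) (n : nat) (lam : 'I_n -> R) (p q : osc R n) :
  'd (osc_mul lam p) q = osc_dmul lam p :> (osc R n -> osc R n).
Proof. by apply/funext => v; exact: diff_osc_mul. Qed.

Lemma kmetricE (R : realType) (n : nat) (lam : 'I_n -> R)
    (u : osc R n -> osc R n) (p v w : osc R n) :
  kmetric lam u p v w = kform lam (u (osc_dmul lam (osc_inv lam p) v))
                                  (osc_dmul lam (osc_inv lam p) w).
Proof.
rewrite /kmetric; congr (kform _ (u _) _); exact: diff_osc_mul.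
Qed.

Lemma kmetric_left_invariant (R : realType) (n : nat) (lam : 'I_n -> R)
    (u : osc R n -> osc R n) (q p v w : osc R n) :
  kmetric lam u (osc_mul lam q p)
    ('d (osc_mul lam q) p v) ('d (osc_mul lam q) p w) = kmetric lam u p v w.
Proof.
have E : osc_mul lam (osc_inv lam (osc_mul lam q p)) q = osc_inv lam p.
  rewrite -[LHS](osc_mulp0 lam) -(osc_mulpV lam p) osc_mulA.
  by rewrite -(osc_mulA lam _ q) osc_mulVp osc_mul0p.
rewrite !kmetricE (diff_osc_mulE lam q p).
by rewrite -!osc_dmulM E.
Qed.

Lemma kmetric0 (R : realType) (n : nat) (lam : 'I_n -> R)
    (u : osc R n -> osc R n) (v w : osc R n) :
  kmetric lam u 0 v w = kform lam (u v) w.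
Proof.
have dmul0 x : osc_dmul lam 0 x = x.
  apply: osc_eqP => [//||j].
    rewrite -[LHS]/(_ + _ * _) big1 ?mulr0 ?addr0 // => j _.
    by rewrite osc_z0 rmorph0 !mul0r.
  by rewrite osc_z_mk [osc_t 0 * _]mul0r expi0 mul1r.
rewrite kmetricE; suff -> : osc_inv lam 0 = 0 by rewrite !dmul0.
by rewrite -[LHS](osc_mulp0 lam) osc_mulVp.
Qed.

Lemma derive_line (R : realType) (V W : normedModType R) (f : V -> W) (v : V) (l : W) :
  is_derive (0 : R) 1 (fun h => f (h *: v)) l -> 'D_v f 0 = l.
Proof.
move=> H; have <- := derive_val (is_derive:=H).
rewrite /derive.
apply: (congr1 (fun F : R -> W => lim (F @ (0 : R)^')%classic)).
apply/funext => h /=.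
by rewrite !addr0 scale0r [h *: 1]mulr1.
Qed.

Lemma is_deriveZl (R : realType) (W : normedModType R) (k : R -> R) (w : W) (x l : R) :
  is_derive x 1 k l -> is_derive x 1 (fun h => k h *: w) (l *: w).
Proof.
move=> H; have dk : differentiable k x by apply/derivable1_diffP.
have dkw := differentiableZl w dk.
apply: DeriveDef; first exact/derivable1_diffP.
by rewrite deriveE // diffZl // -deriveE // derive_val.
Qed.

Lemma is_derive_combo (R : realType) (W : normedModType R) n (w0 e0 : W)
    (e f : 'I_n -> W) (S : R -> R) (X Y : 'I_n -> R -> R) S' X' Y' :
  is_derive (0 : R) 1 S S' -> (forall j, is_derive (0 : R) 1 (X j) (X' j)) ->
  (forall j, is_derive (0 : R) 1 (Y j) (Y' j)) ->
  is_derive (0 : R) 1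
    (fun h => w0 + S h *: e0 + \sum_j X j h *: e j + \sum_j Y j h *: f j)
    (S' *: e0 + \sum_j X' j *: e j + \sum_j Y' j *: f j).
Proof.
move=> dS dX dY.
have := is_deriveD (is_deriveD (is_deriveD
  (is_derive_cst w0 (0 : R) 1) (is_deriveZl e0 dS))
  (is_derive_sum (fun j => is_deriveZl (e j) (dX j))))
  (is_derive_sum (fun j => is_deriveZl (f j) (dY j))).
rewrite add0r (_ : _ + _ = (fun h : R => w0 + S h *: e0 + \sum_j X j h *: e j + \sum_j Y j h *: f j)) //.
by apply/funext => h; rewrite !fctE /= !fct_sumE.
Qed.

(* The first term of [osc_bracket]. *)
Definition osc_D (R : realType) (n : nat) (lam : 'I_n -> R) (v w : osc R n) :
  osc R n := osc_mk 0 (2^-1 * \sum_j complex.Im (conjc (osc_z v j) * osc_z w j))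
    (fun j => Complex 0 (osc_t v * lam j) * osc_z w j).

Lemma derive_osc_dmul (R : realType) (n : nat) (lam : 'I_n -> R) (v w : osc R n) :
  'D_v (fun p => osc_dmul lam p w) 0 = osc_D lam v w.
Proof.
pose c j := osc_t v * lam j.
pose A j := osc_x v j * osc_y w j - osc_y v j * osc_x w j.
pose B j := osc_x v j * osc_x w j + osc_y v j * osc_y w j.
pose S h := osc_s w + 2^-1 * \sum_j h * (A j * cos (h * c j) + B j * sin (h * c j)).
pose X j h := cos (h * c j) * osc_x w j - sin (h * c j) * osc_y w j.
pose Y j h := cos (h * c j) * osc_y w j + sin (h * c j) * osc_x w j.
have fE : (fun h : R => osc_dmul lam (h *: v) w) =
  (fun h => osc_t w *: osc_em1 R n + S h *: osc_e0 R n
  + \sum_j X j h *: osc_e R j + \sum_j Y j h *: osc_ec R j).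
  apply/funext => h; rewrite [LHS]osc_basis_sum.
  have zE j : osc_z (osc_dmul lam (h *: v) w) j = expi (h * c j) * osc_z w j.
    by rewrite osc_z_mk -[osc_t (h *: v)]/(h * osc_t v) -mulrA.
  have xE j : osc_x (osc_dmul lam (h *: v) w) j = X j h.
    by have := congr1 (@complex.Re R) (zE j).
  have yE j : osc_y (osc_dmul lam (h *: v) w) j = Y j h.
    by have := congr1 (@complex.Im R) (zE j).
  have sE : osc_s (osc_dmul lam (h *: v) w) = S h.
    rewrite -[LHS]/(_ + _ * _) /S; congr (_ + _ * _); apply: eq_bigr => j _.
    rewrite osc_zZ -[osc_t (h *: v)]/(h * osc_t v) -(mulrA h) /osc_z /=.
    by rewrite /A /B /c; ring.
  rewrite sE.
  under eq_bigr => j _ do rewrite xE.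
  by under [X in _ + X = _]eq_bigr => j _ do rewrite yE.
have dl j : is_derive (0 : R) 1 (fun h : R => h * c j) (c j).
  by apply: is_derive_eq; rewrite ?scaler0 ?add0r ?addr0 /= [_ *: _]mulr1.
have dc j : is_derive (0 : R) 1 (fun h : R => cos (h * c j)) 0.
  have := @is_derive1_comp _ cos (fun h => h * c j) 0 _ _ (is_derive_cos _) (dl j).
  by rewrite mul0r sin0 oppr0 mul0r.
have ds j : is_derive (0 : R) 1 (fun h : R => sin (h * c j)) (c j).
  have := @is_derive1_comp _ sin (fun h => h * c j) 0 _ _ (is_derive_sin _) (dl j).
  by rewrite mul0r cos0 mul1r.
have dA (f g : R -> R) a b k l : is_derive (0 : R) 1 f k -> is_derive (0 : R) 1 g l ->
    is_derive (0 : R) 1 (fun h => a * f h + b * g h) (a * k + b * l).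
  by move=> fk gl; exact: (is_deriveD (is_deriveZ a fk) (is_deriveZ b gl)).
have dX j : is_derive (0 : R) 1 (X j) (- (c j * osc_y w j)).
  have := dA _ _ (osc_x w j) (- osc_y w j) _ _ (dc j) (ds j).
  rewrite mulr0 add0r mulNr mulrC (_ : (fun h => _) = X j) //.
  by apply/funext => h; rewrite /X; ring.
have dY j : is_derive (0 : R) 1 (Y j) (c j * osc_x w j).
  have := dA _ _ (osc_y w j) (osc_x w j) _ _ (dc j) (ds j).
  rewrite mulr0 add0r mulrC (_ : (fun h => _) = Y j) //.
  by apply/funext => h; rewrite /Y; ring.
have dS : is_derive (0 : R) 1 S (2^-1 * \sum_j A j).
  have dT j : is_derive (0 : R) 1
      (fun h => h * (A j * cos (h * c j) + B j * sin (h * c j))) (A j).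
    have := is_deriveM (is_derive_id (0 : R) 1) (dA _ _ (A j) (B j) _ _ (dc j) (ds j)).
    move=> /is_derive_eq; apply.
    by rewrite !mul0r cos0 sin0 scale0r add0r mulr0 addr0 mulr1 [_ *: 1]mulr1.
  have := is_deriveD (is_derive_cst (osc_s w) (0 : R) 1) (is_deriveZ 2^-1 (is_derive_sum dT)).
  rewrite add0r (_ : _ + _ = S) //.
  by apply/funext => h; rewrite /S !fctE /= fct_sumE.
have := is_derive_combo (osc_t w *: osc_em1 R n) (osc_e0 R n)
  (@osc_e R n) (@osc_ec R n) dS dX dY.
rewrite -fE => H; rewrite (@derive_line _ _ _ (fun p => osc_dmul lam p w) v _ H).
rewrite [RHS]osc_basis_sum -[osc_t (osc_D _ _ _)]/0 scale0r add0r.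
have -> : osc_s (osc_D lam v w) = 2^-1 * \sum_j A j.
  congr (_ * _); apply: eq_bigr => j _.
  by rewrite /A /osc_z /= mulNr.
have zE j : osc_z (osc_D lam v w) j = Complex (- (c j * osc_y w j)) (c j * osc_x w j).
  rewrite osc_z_mk /osc_z /c; apply/eqP; rewrite eq_complex /=.
  by rewrite !mul0r sub0r add0r !eqxx.
have xE j : osc_x (osc_D lam v w) j = - (c j * osc_y w j).
  by have := congr1 (@complex.Re R) (zE j).
have yE j : osc_y (osc_D lam v w) j = c j * osc_x w j.
  by have := congr1 (@complex.Im R) (zE j).
under [X in _ = _ + X + _]eq_bigr => j _ do rewrite xE.
by under [X in _ = _ + X]eq_bigr => j _ do rewrite yE.
Qed.

Lemma osc_bracketE (R : realType) (n : nat) (lam : 'I_n -> R) (v w : osc R n) :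
  osc_bracket lam v w = osc_mk 0
    (\sum_j (osc_x v j * osc_y w j - osc_y v j * osc_x w j))
    (fun j => Complex 0 (lam j) *
              ((osc_t v)%:C%C * osc_z w j - (osc_t w)%:C%C * osc_z v j)).
Proof.
have H x y : 'D_x (fun p => 'd (osc_mul lam p) 0 y) 0 = osc_D lam x y.
  rewrite -derive_osc_dmul; congr ('D_x _ 0); apply/funext => p.
  exact: diff_osc_mul.
rewrite /osc_bracket !H.
have zB (x y : osc R n) j : osc_z (x - y) j = osc_z x j - osc_z y j.
  by rewrite osc_zD -scaleN1r osc_zZ rmorphN1 mulN1r.
apply: osc_eqP => [||j].
- exact: subrr.
- rewrite -[LHS]/(_ * _ - _ * _) -mulrBr -sumrB mulr_sumr.
  apply: eq_bigr => j _; rewrite /osc_z /=.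
  by field.
- rewrite zB !osc_z_mk /osc_z; apply/eqP; rewrite eq_complex /=.
  by apply/andP; split; apply/eqP; ring.
Qed.

Lemma osc_bracket_em1_e (R : realType) (n : nat) (lam : 'I_n -> R) j :
  osc_bracket lam (osc_em1 R n) (osc_e R j) = lam j *: osc_ec R j.
Proof.
rewrite osc_bracketE; apply: osc_eqP => [||k].
- exact/esym/mulr0.
- rewrite [RHS]mulr0 -[LHS]/(\sum_k _) big1 // => k _.
  by rewrite /osc_x /osc_y /= !mxE; ring.
- rewrite osc_z_mk osc_zZ /osc_z /osc_x /osc_y /= !mxE; apply/eqP.
  rewrite eq_complex /= /osc_t /=; case: (eqVneq k j) => [->|_];
  by rewrite ?[true%:R]mulr1n ?[false%:R]mulr0n; apply/andP; split; apply/eqP; ring.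
Qed.

Lemma osc_bracket_em1_ec (R : realType) (n : nat) (lam : 'I_n -> R) j :
  osc_bracket lam (osc_em1 R n) (osc_ec R j) = - lam j *: osc_e R j.
Proof.
rewrite osc_bracketE; apply: osc_eqP => [||k].
- exact/esym/mulr0.
- rewrite [RHS]mulr0 -[LHS]/(\sum_k _) big1 // => k _.
  by rewrite /osc_x /osc_y /= !mxE; ring.
- rewrite osc_z_mk osc_zZ /osc_z /osc_x /osc_y /= !mxE; apply/eqP.
  rewrite eq_complex /= /osc_t /=; case: (eqVneq k j) => [->|_];
  by rewrite ?[true%:R]mulr1n ?[false%:R]mulr0n; apply/andP; split; apply/eqP; ring.
Qed.

Lemma osc_bracket_e_ec (R : realType) (n : nat) (lam : 'I_n -> R) i j :
  osc_bracket lam (osc_e R i) (osc_ec R j) = (i == j)%:R *: osc_e0 R n.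
Proof.
rewrite osc_bracketE; apply: osc_eqP => [||k].
- exact/esym/mulr0.
- rewrite [RHS]mulr1 -[LHS]/(\sum_k _) (bigD1 i) //= big1 => [|k ki].
    rewrite /osc_x /osc_y /= !mxE !eqxx /= (eq_sym i j); ring.
  by rewrite /osc_x /osc_y /= !mxE (negbTE ki) /=; ring.
- rewrite osc_z_mk osc_zZ /osc_z /osc_x /osc_y /= !mxE; apply/eqP.
  by rewrite eq_complex /= /osc_t /=; apply/andP; split; apply/eqP; ring.
Qed.

(* Main.v *)
(**
In the coordinates t, zeta_j = e^{- i nu_j t} z_j and
s' = s + (alpha / 2) t + sum_j c_j Re(zeta_j) Im(zeta_j), where zeta_j = x_j + i y_j
and u(e_{-1}) = e_{-1} + alpha e_0, for suitable nu_j and c_j, the metric k_u becomes the Cahen-Wallach plane wave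
  2 dt ds' + sum_j (A_j dx_j^2 + B_j dy_j^2)
           - sum_j nu_j^2 (A_j x_j^2 + B_j y_j^2) dt^2
with A_j = eta_j / lambda_j and B_j = check-eta_j / lambda_j.  In case (a) the
rotation has nu_j = lambda_j and what remains is absorbed in s'; in case (b)
nu_j = lambda_j / (2 eta_j) and c_j = 0.

The Christoffel symbols of the plane wave are linear in the base point, its
curvature has constant coefficients and is parallel, and its geodesics are given
by cosines and sines.  All of this is carried back to the oscillator group by
the global change of coordinates.  The map - id of the plane wave is an isometry
which reverses the tangent space at the unit; conjugating it by left
translations gives the symmetries at the other points.
*)

Require Import Defs.
From HB Require Import structures.
From mathcomp Require Import all_boot all_order all_algebra.
From mathcomp Require Import complex ring.
From mathcomp Require Import all_classical all_reals all_analysis.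
Import Order.TTheory GRing.Theory Num.Theory.
Import numFieldNormedType.Exports.
Local Open Scope ring_scope.

Set Implicit Arguments.
Unset Strict Implicit.
Unset Printing Implicit Defensive.

(** * Elementary functions *)

(** Conditions (a) and (b) are integrability conditions. Substitute dz_j = e^{i nu_j t} (dzeta_j + i
    nu_j zeta_j dt) in k_u. If eta_j = check-eta_j, the transverse form does not see rotations, so
    nu_j is free and is spent on killing the cross term dt (x dy - y dx), whose coefficient is 2
    eta_j nu_j / lambda_j - 1. Otherwise the left-invariant frame forces nu_j = lambda_j, and the
    cross terms are dt ((2 check-eta_j - 1) x dy + (1 - 2 eta_j) y dx). A change of s absorbs them
    when the two coefficients agree, that is when eta_j + check-eta_j = 1: they then form (1 - 2
    eta_j) dt d(xy). Christoffel symbols of k_u are never written out in group coordinates; they are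
    handled only through their image under the differential of the chart, where they become those of
    the plane wave. Symmetry is not inferred from completeness and local symmetry: the reflections
    are explicit. The plane wave metric depends on the base point, so - id is used only at the
    origin, and left invariance provides the homogeneity. *)

(* Stable under directional derivatives and composition, so that smoothness and
   the symmetry of second derivatives are obtained by induction. *)
Inductive elementary (R : realType) (V : normedModType R) : (V -> R) -> Prop :=
| elementary_cst c : elementary (fun=> c)
| elementary_linear (l : {linear V -> R}) : continuous l -> elementary l
| elementaryD f g : elementary f -> elementary g ->
    elementary (fun p => f p + g p)
| elementaryM f g : elementary f -> elementary g ->
    elementary (fun p => f p * g p)
| elementary_sin f : elementary f -> elementary (fun p => sin (f p))
| elementary_cos f : elementary f -> elementary (fun p => cos (f p)).

(** Finite sums of scalar functions times fixed vectors: no basis of [W] has to be chosen, and every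
    statement reduces to the scalar coefficients by induction. *)
Inductive elementary_map (R : realType) (V W : normedModType R) :
    (V -> W) -> Prop :=
| elementary_map0 : elementary_map (fun=> 0)
| elementary_map_cons f e F : elementary f -> elementary_map F ->
    elementary_map (fun p => f p *: e + F p).

Lemma elementaryB (R : realType) (V : normedModType R) (f g : V -> R) :
  elementary f -> elementary g -> elementary (fun p => f p - g p).
Proof.
move=> f0 g0; have -> : (fun p => f p - g p) = fun p => f p + (-1) * g p.
  by apply/funext => p; rewrite mulN1r.
by apply: elementaryD => //; apply: (elementaryM (elementary_cst _ (-1))).
Qed.

Lemma is_derive_comp1 (R : realType) (V : normedModType R) (f : R -> R)
    (g : V -> R) (p v : V) (df : R) :
  differentiable g p -> is_derive (g p) 1 f df ->
  is_derive p v (fun q => f (g q)) (df * 'D_v g p).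
Proof.
move=> dg df1.
have dfg : differentiable f (g p) by apply/derivable1_diffP.
have dc := differentiable_comp dg dfg.
apply: DeriveDef; first exact: diff_derivable.
rewrite (deriveE v dc) diff_comp //= -(deriveE v dg).
rewrite -{1}['D_v g p]mulr1 -[_ * 1]/(_ *: 1) linearZ /= -deriveE // derive_val.
by rewrite mulrC.
Qed.

(** One induction produces both orders of derivatives: the second derivative of a product or of a
    sine involves first derivatives of the parts. Each resulting formula is symmetric in [v] and [w]
    by commutativity of multiplication, which yields the Schwarz theorem for this class. *)
Lemma elementary_jet (R : realType) (V : normedModType R) (f : V -> R) :
  elementary f ->
  exists df d2f, [/\ forall p, differentiable f p, forall v, elementary (df v),
    forall p v, is_derive p v f (df v p),
    forall p v w, is_derive p v (df w) (d2f v w p) &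
    forall p v w, d2f v w p = d2f w v p].
Proof.
elim=> {f}.
- move=> c; exists (fun _ _ => 0), (fun _ _ _ => 0).
  split=> [p|v|p v|p v w|//].
  + exact: differentiable_cst.
  + exact: elementary_cst.
  + exact: is_derive_cst.
  + exact: is_derive_cst.
- move=> l lc; exists (fun v _ => l v), (fun _ _ _ => 0).
  have dl p : differentiable l p by exact: linear_differentiable.
  split=> [//|v|p v|p v w|//].
  + exact: elementary_cst.
  + apply: DeriveDef; first exact: diff_derivable.
    by rewrite (deriveE v (dl p)) (diff_lin _ lc).
  + exact: is_derive_cst.
- move=> f g _ [df [d2f [ff ef Df D2f sf]]] _ [dg [d2g [fg eg Dg D2g sg]]].
  exists (fun v p => df v p + dg v p), (fun v w p => d2f v w p + d2g v w p).
  split=> [p|v|p v|p v w|p v w].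
  + exact: (differentiableD (ff p) (fg p)).
  + exact: elementaryD.
  + exact: (is_deriveD (Df p v) (Dg p v)).
  + exact: (is_deriveD (D2f p v w) (D2g p v w)).
  + by rewrite sf sg.
- move=> f g f0 [df [d2f [ff ef Df D2f sf]]] g0 [dg [d2g [fg eg Dg D2g sg]]].
  exists (fun v p => f p * dg v p + g p * df v p).
  exists (fun v w p => f p * d2g v w p + dg w p * df v p
                       + (g p * d2f v w p + df w p * dg v p)).
  split=> [p|v|p v|p v w|p v w].
  + exact: (differentiableM (ff p) (fg p)).
  + by apply: elementaryD; apply: elementaryM.
  + exact: (is_deriveM (Df p v) (Dg p v)).
  + exact: (is_deriveD (is_deriveM (Df p v) (D2g p v w))
                       (is_deriveM (Dg p v) (D2f p v w))).
  + by rewrite sf sg; ring.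
- move=> f f0 [df [d2f [ff ef Df D2f sf]]].
  have E p v : 'D_v f p = df v p by exact: (@derive_val _ _ _ _ _ _ _ (Df p v)).
  exists (fun v p => cos (f p) * df v p).
  exists (fun v w p => cos (f p) * d2f v w p + df w p * (- sin (f p) * df v p)).
  have Ds p v := is_derive_comp1 v (ff p) (is_derive_sin (f p)).
  have Dc p v := is_derive_comp1 v (ff p) (is_derive_cos (f p)).
  split=> [p|v|p v|p v w|p v w].
  + apply: (differentiable_comp (ff p)).
    by apply/derivable1_diffP; have [] := is_derive_sin (f p).
  + by apply: elementaryM => //; exact: elementary_cos.
  + by rewrite -(E p v); exact: Ds.
  + by rewrite -(E p v); exact: (is_deriveM (Dc p v) (D2f p v w)).
  + by rewrite sf; ring.
- move=> f f0 [df [d2f [ff ef Df D2f sf]]].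
  have E p v : 'D_v f p = df v p by exact: (@derive_val _ _ _ _ _ _ _ (Df p v)).
  exists (fun v p => - sin (f p) * df v p).
  exists (fun v w p => - sin (f p) * d2f v w p + df w p * - (cos (f p) * df v p)).
  have Ds p v := is_derive_comp1 v (ff p) (is_derive_sin (f p)).
  have Dc p v := is_derive_comp1 v (ff p) (is_derive_cos (f p)).
  split=> [p|v|p v|p v w|p v w].
  + apply: (differentiable_comp (ff p)).
    by apply/derivable1_diffP; have [] := is_derive_cos (f p).
  + apply: elementaryM => //.
    rewrite (_ : (fun p => - sin (f p)) = fun p => (fun=> -1) p * sin (f p)).
      by apply: elementaryM; [exact: elementary_cst|exact: elementary_sin].
    by apply/funext => p; rewrite mulN1r.
  + by rewrite -(E p v); exact: Dc.
  + by rewrite -(E p v); exact: (is_deriveM (is_deriveN (Ds p v)) (D2f p v w)).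
  + by rewrite sf; ring.
Qed.

Lemma elementary_map_jet (R : realType) (V W : normedModType R) (F : V -> W) :
  elementary_map F ->
  exists dF d2F, [/\ forall p, differentiable F p,
    forall v, elementary_map (dF v),
    forall p v, is_derive p v F (dF v p),
    forall p v w, is_derive p v (dF w) (d2F v w p) &
    forall p v w, d2F v w p = d2F w v p].
Proof.
have Zl (f : V -> R) e p v l : is_derive p v f l ->
    differentiable f p -> is_derive p v (fun q => f q *: e : W) (l *: e).
  move=> fl df; apply: DeriveDef.
    exact/diff_derivable/differentiableZl.
  rewrite (deriveE v (differentiableZl e df)) diffZl //.
  by rewrite -(deriveE v df) (@derive_val _ _ _ _ _ _ _ fl).
elim=> {F} [|f e F f0 _ [dF [d2F [fF eF DF D2F sF]]]].
  exists (fun _ _ => 0), (fun _ _ _ => 0).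
  split=> [p|v|p v|p v w|//].
  + exact: differentiable_cst.
  + exact: elementary_map0.
  + exact: is_derive_cst.
  + exact: is_derive_cst.
have [df [d2f [ff ef Df D2f sf]]] := elementary_jet f0.
exists (fun v p => df v p *: e + dF v p).
exists (fun v w p => d2f v w p *: e + d2F v w p).
split=> [p|v|p v|p v w|p v w].
+ exact: (differentiableD (differentiableZl e (ff p)) (fF p)).
+ exact: elementary_map_cons.
+ exact: (is_deriveD (Zl _ e _ _ _ (Df p v) (ff p)) (DF p v)).
+ have [_ [_ [fdf _ _ _ _]]] := elementary_jet (ef w).
  exact: (is_deriveD (Zl _ e _ _ _ (D2f p v w) (fdf p)) (D2F p v w)).
+ by rewrite sf sF.
Qed.

Lemma elementary_map_differentiable (R : realType) (V W : normedModType R)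
    (F : V -> W) p : elementary_map F -> differentiable F p.
Proof. by move=> /elementary_map_jet[dF [d2F []]]. Qed.

Lemma elementary_map_derivable (R : realType) (V W : normedModType R)
    (F : V -> W) p v : elementary_map F -> derivable F p v.
Proof. by move=> F0; exact/diff_derivable/elementary_map_differentiable. Qed.

Lemma elementary_map_is_derive (R : realType) (V W : normedModType R)
    (F : V -> W) p v : elementary_map F -> is_derive p v F ('D_v F p).
Proof. by move=> F0; exact/derivableP/elementary_map_derivable. Qed.

Lemma is_derive_val (R : realType) (V W : normedModType R) (F : V -> W) p v l :
  is_derive p v F l -> 'D_v F p = l.
Proof. by case. Qed.

Lemma elementary_mapD1 (R : realType) (V W : normedModType R) (F : V -> W) v :
  elementary_map F -> elementary_map (fun p => 'D_v F p).
Proof.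
move=> /elementary_map_jet[dF [d2F [_ eF DF _ _]]].
suff -> : (fun p => 'D_v F p) = dF v by [].
by apply/funext => p; exact: is_derive_val.
Qed.

Lemma elementary_map_schwarz (R : realType) (V W : normedModType R) (F : V -> W)
    p v w : elementary_map F ->
  'D_v (fun q => 'D_w F q) p = 'D_w (fun q => 'D_v F q) p.
Proof.
move=> /elementary_map_jet[dF [d2F [_ eF DF D2F sF]]].
have E u : (fun q => 'D_u F q) = dF u.
  by apply/funext => q; exact: is_derive_val.
by rewrite !E (is_derive_val (D2F p v w)) (is_derive_val (D2F p w v)).
Qed.

Lemma elementary_map_smooth (R : realType) (V W : normedModType R) (F : V -> W) :
  elementary_map F -> smooth F.
Proof.
move=> F0 vs p; apply: elementary_map_differentiable.
by elim: vs => //= v vs; exact: elementary_mapD1.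
Qed.

Lemma elementary_mapD (R : realType) (V W : normedModType R) (F G : V -> W) :
  elementary_map F -> elementary_map G -> elementary_map (fun p => F p + G p).
Proof.
move=> F0 G0; elim: F0 => [|f e {}F f0 _ IH].
  by rewrite (_ : (fun _ => _) = G) //; apply/funext => p; rewrite add0r.
rewrite (_ : (fun _ => _) = fun p => f p *: e + (F p + G p)).
  exact: elementary_map_cons.
by apply/funext => p; rewrite addrA.
Qed.

Lemma elementary_mapZ (R : realType) (V W : normedModType R) (f : V -> R)
    (F : V -> W) :
  elementary f -> elementary_map F -> elementary_map (fun p => f p *: F p).
Proof.
move=> f0; elim=> [|g e {}F g0 _ IH].
  rewrite (_ : (fun _ => _) = fun=> 0); first exact: elementary_map0.
  by apply/funext => p; rewrite scaler0.
rewrite (_ : (fun _ => _) = fun p => (f p * g p) *: e + f p *: F p).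
  by apply: elementary_map_cons => //; exact: elementaryM.
by apply/funext => p; rewrite scalerDr scalerA.
Qed.

Lemma elementary_mapZl (R : realType) (V W : normedModType R) (f : V -> R)
    (e : W) : elementary f -> elementary_map (fun p => f p *: e).
Proof.
move=> f0; rewrite (_ : (fun _ => _) = fun p => f p *: e + 0).
  by apply: elementary_map_cons => //; exact: elementary_map0.
by apply/funext => p; rewrite addr0.
Qed.

Lemma elementary_map_cst (R : realType) (V W : normedModType R) (e : W) :
  elementary_map (fun _ : V => e).
Proof.
rewrite (_ : (fun _ => _) = fun p => (fun=> 1) p *: e).
  by apply: elementary_mapZl; exact: elementary_cst.
by apply/funext => p; rewrite scale1r.
Qed.

Lemma elementary_map_sum (R : realType) (V W : normedModType R) (I : Type)
    (r : seq I) (F : I -> V -> W) :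
  (forall i, elementary_map (F i)) ->
  elementary_map (fun p => \sum_(i <- r) F i p).
Proof.
move=> F0; elim: r => [|i r IH].
  rewrite (_ : (fun _ => _) = fun=> 0); first exact: elementary_map0.
  by apply/funext => p; rewrite big_nil.
rewrite (_ : (fun _ => _) = fun p => F i p + \sum_(j <- r) F j p).
  exact: elementary_mapD.
by apply/funext => p; rewrite big_cons.
Qed.

Lemma elementary_scalar_map (R : realType) (V : normedModType R) (f : V -> R) :
  elementary f -> elementary_map f.
Proof.
move=> f0; rewrite (_ : f = fun p => f p *: 1); first exact: elementary_mapZl.
by apply/funext => p; rewrite [_ *: _]mulr1.
Qed.

Lemma elementary_map_scalar (R : realType) (V : normedModType R) (f : V -> R) :
  elementary_map f -> elementary f.
Proof.
elim=> [|g e F g0 _ IH]; first exact: elementary_cst.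
apply: elementaryD => //; apply: (@elementaryM _ _ g (fun=> e)) => //.
exact: elementary_cst.
Qed.

Lemma elementary_sum (R : realType) (V : normedModType R) (I : Type)
    (r : seq I) (F : I -> V -> R) :
  (forall i, elementary (F i)) -> elementary (fun p => \sum_(i <- r) F i p).
Proof.
move=> F0; apply: elementary_map_scalar; apply: elementary_map_sum => i.
exact: elementary_scalar_map.
Qed.

(** Continuity of [L] is not assumed: [L] only ever meets the fixed vectors of the sum. *)
Lemma elementary_map_linear (R : realType) (V W U : normedModType R)
    (F : V -> W) (L : {linear W -> U}) :
  elementary_map F -> elementary_map (fun p => L (F p)).
Proof.
elim=> [|f e G f0 _ IH].
  rewrite (_ : (fun _ => _) = fun=> 0); first exact: elementary_map0.
  by apply/funext => p; rewrite linear0.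
rewrite (_ : (fun _ => _) = fun p => f p *: L e + L (G p)).
  exact: elementary_map_cons.
by apply/funext => p; rewrite linearP.
Qed.

Lemma elementary_comp (R : realType) (V W : normedModType R) (f : W -> R)
    (F : V -> W) :
  elementary f -> elementary_map F -> elementary (fun p => f (F p)).
Proof.
move=> f0 F0; elim: f0 => {f} [c|l _|f g _ IHf _ IHg|f g _ IHf _ IHg|f _ IH|f _ IH].
- exact: elementary_cst.
- exact/elementary_map_scalar/elementary_map_linear.
- exact: elementaryD.
- exact: elementaryM.
- exact: elementary_sin.
- exact: elementary_cos.
Qed.

Lemma elementary_map_comp (R : realType) (V W U : normedModType R)
    (G : W -> U) (F : V -> W) :
  elementary_map G -> elementary_map F -> elementary_map (fun p => G (F p)).
Proof.
move=> G0 F0; elim: G0 => [|f e {}G f0 _ IH]; first exact: elementary_map0.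
by apply: (@elementary_map_cons _ _ _ (fun p => f (F p))) => //; exact: elementary_comp.
Qed.

Lemma elementary_map_chain (R : realType) (V W U : normedModType R)
    (G : W -> U) (F : V -> W) p v :
  elementary_map G -> elementary_map F ->
  'D_v (fun q => G (F q)) p = 'D_('D_v F p) G (F p).
Proof.
move=> G0 F0.
have dF := elementary_map_differentiable p F0.
have dG := elementary_map_differentiable (F p) G0.
rewrite (deriveE v (differentiable_comp dF dG)) diff_comp //=.
by rewrite -(deriveE v dF) (deriveE _ dG).
Qed.

Lemma elementary_map_diff (R : realType) (V W : normedModType R)
    (F : V -> W) p v : elementary_map F -> 'd F p v = 'D_v F p.
Proof.
by move=> F0; rewrite (deriveE v (elementary_map_differentiable p F0)).
Qed.

Lemma elementary_map_derive_linear (R : realType) (V W : normedModType R)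
    (F : V -> W) p : elementary_map F -> linear (fun v => 'D_v F p).
Proof.
move=> F0 a v w; rewrite -!(elementary_map_diff _ _ F0).
exact: linearP.
Qed.

Lemma elementary_map_deriveD (R : realType) (V W : normedModType R)
    (F G : V -> W) p v : elementary_map F -> elementary_map G ->
  'D_v (fun q => F q + G q) p = 'D_v F p + 'D_v G p.
Proof. by move=> F0 G0; apply: deriveD; exact: elementary_map_derivable. Qed.

Lemma elementary_deriveZl (R : realType) (V W : normedModType R)
    (f : V -> R) (e : W) p v : elementary f ->
  'D_v (fun q => f q *: e) p = 'D_v f p *: e.
Proof.
move=> f0.
have df := elementary_map_differentiable p (elementary_scalar_map f0).
by rewrite (deriveE v (differentiableZl e df)) diffZl // -deriveE.
Qed.

Lemma elementary_deriveM (R : realType) (V : normedModType R) (f g : V -> R)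
    p v : elementary f -> elementary g ->
  'D_v (fun q => f q * g q) p = f p * 'D_v g p + g p * 'D_v f p.
Proof.
move=> /elementary_scalar_map f0 /elementary_scalar_map g0.
by apply: deriveM; exact: elementary_map_derivable.
Qed.

Lemma elementary_deriveZ (R : realType) (V W : normedModType R) (f : V -> R)
    (F : V -> W) p v : elementary f -> elementary_map F ->
  'D_v (fun q => f q *: F q) p = f p *: 'D_v F p + 'D_v f p *: F p.
Proof.
move=> f0; elim=> [|g e G g0 G0 IH].
  have -> : (fun q => f q *: (0 : W)) = cst 0.
    by apply/funext => q; rewrite scaler0.
  by rewrite !derive_cst !scaler0 addr0.
have -> : (fun q => f q *: (g q *: e + G q)) =
    fun q => (f q * g q) *: e + f q *: G q.
  by apply/funext => q; rewrite scalerDr scalerA.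
have fg0 := elementaryM f0 g0.
rewrite (elementary_map_deriveD p v (elementary_mapZl e fg0) (elementary_mapZ f0 G0)).
rewrite (elementary_map_deriveD p v (elementary_mapZl e g0) G0) IH.
rewrite (elementary_deriveZl e p v fg0) (elementary_deriveZl e p v g0).
rewrite (elementary_deriveM p v f0 g0) !scalerDr scalerDl !scalerA addrACA.
by rewrite [g p * _]mulrC.
Qed.

Lemma elementary_derive_linear (R : realType) (V W U : normedModType R)
    (F : V -> W) (L : {linear W -> U}) p v :
  elementary_map F -> 'D_v (fun q => L (F q)) p = L ('D_v F p).
Proof.
elim=> [|f e G f0 G0 IH].
  have -> : (fun _ : V => L 0) = cst 0 by apply/funext => q; rewrite linear0.
  by rewrite !derive_cst linear0.
have -> : (fun q => L (f q *: e + G q)) = fun q => f q *: L e + L (G q).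
  by apply/funext => q; rewrite linearP.
have LG := elementary_map_linear L G0.
rewrite (elementary_map_deriveD p v (elementary_mapZl (L e) f0) LG).
rewrite (elementary_map_deriveD p v (elementary_mapZl e f0) G0) IH.
by rewrite !elementary_deriveZl // linearP.
Qed.

(** Product rule for a field of linear operators applied to a moving vector, by induction on the sum
    that represents [Y]. The typical [A q] is the differential of a map at [q], or a multilinear map
    with its other arguments filled in. *)
Lemma elementary_map_leibniz (R : realType) (V W U : normedModType R)
    (A : V -> U -> W) (Y : V -> U) :
  (forall q, linear (A q)) -> (forall e, elementary_map (fun q => A q e)) ->
  elementary_map Y ->
  elementary_map (fun q => A q (Y q)) /\
  forall p v, 'D_v (fun q => A q (Y q)) p =
              'D_v (fun q => A q (Y p)) p + A p ('D_v Y p).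
Proof.
move=> lA eA.
pose M q := GRing.isLinear.Build _ _ _ _ _ (lA q).
pose L q : {linear U -> W} := HB.pack (A q) (M q).
have AE q : A q = L q :> (U -> W) by [].
have A0 q : A q 0 = 0 by rewrite AE linear0.
elim=> [|f e G f0 G0 [IH1 IH2]].
  have -> : (fun q : V => A q 0) = cst 0 by apply/funext => q.
  split; first exact: elementary_map0.
  by move=> p v; rewrite !derive_cst A0 addr0.
have -> : (fun q => A q (f q *: e + G q)) = fun q => f q *: A q e + A q (G q).
  by apply/funext => q; rewrite lA.
have eZ := elementary_mapZ f0 (eA e).
split; first exact: elementary_mapD.
move=> p v.
have lA1 := elementary_map_deriveD p v (elementary_mapZ f0 (eA e)) IH1.
(* The same expansion for the vector frozen at [p]: its coefficient [f p] is constant, so the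
   derivative of [f] does not appear here. *)
have lA2 := elementary_map_deriveD p v (elementary_mapZ (elementary_cst _ (f p)) (eA e)) (eA (G p)).
have -> : (fun q => A q (f p *: e + G p)) = fun q => f p *: A q e + A q (G p).
  by apply/funext => q; rewrite lA.
rewrite lA1 lA2 IH2 elementary_deriveZ // elementary_deriveZ //; last first.
  exact: elementary_cst.
rewrite (elementary_map_deriveD p v (elementary_mapZl e f0) G0).
rewrite (elementary_deriveZl e p v f0) lA derive_cst scale0r addr0.
by rewrite -!addrA; congr (_ + _); rewrite addrCA.
Qed.

(** * Pull-back of connections *)

Lemma elementary_map_lin (R : realType) (V W U : normedModType R)
    (L : W -> U) (F : V -> W) : linear L -> elementary_map F ->
  elementary_map (fun p => L (F p)) /\
  forall p v, 'D_v (fun q => L (F q)) p = L ('D_v F p).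
Proof.
move=> lL F0; pose M := GRing.isLinear.Build _ _ _ _ _ lL.
pose L' : {linear W -> U} := HB.pack L M.
split; first exact: (elementary_map_linear L').
by move=> p v; exact: (elementary_derive_linear L').
Qed.

Lemma elementary_map_bilin (R : realType) (V W1 W2 U : normedModType R)
    (b : W1 -> W2 -> U) (F : V -> W1) (G : V -> W2) :
  (forall v, linear (b v)) -> (forall w, linear (b^~ w)) ->
  elementary_map F -> elementary_map G ->
  elementary_map (fun p => b (F p) (G p)) /\
  forall p v, 'D_v (fun q => b (F q) (G q)) p =
              b ('D_v F p) (G p) + b (F p) ('D_v G p).
Proof.
move=> br bl F0 G0.
have bF w := elementary_map_lin (bl w) F0.
have [e D] := elementary_map_leibniz (fun q => br (F q)) (fun w => (bF w).1) G0.
by split=> // p v; rewrite D; case: (bF (G p)) => _ ->.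
Qed.

Definition trilinear (R : realType) (V W : normedModType R)
    (T : V -> V -> V -> W) : Prop :=
  [/\ forall v w, linear (T v w), forall v w, linear (fun x => T v x w) &
      forall v w, linear (fun x => T x v w)].

Lemma elementary_map_trilin (R : realType) (V W U : normedModType R)
    (T : W -> W -> W -> U) (F G H : V -> W) : trilinear T ->
  elementary_map F -> elementary_map G -> elementary_map H ->
  elementary_map (fun p => T (F p) (G p) (H p)) /\
  forall p v, 'D_v (fun q => T (F q) (G q) (H q)) p =
    T ('D_v F p) (G p) (H p) + T (F p) ('D_v G p) (H p)
    + T (F p) (G p) ('D_v H p).
Proof.
move=> [l3 l2 l1] F0 G0 H0.
have bFG w := @elementary_map_bilin _ _ _ _ _ (fun x y => T x y w) _ _
  (fun x => l2 x w) (fun y => l1 y w) F0 G0.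
have [e D] := elementary_map_leibniz (fun q => l3 (F q) (G q))
  (fun w => (bFG w).1) H0.
by split=> // p v; rewrite D; case: (bFG (H p)) => _ ->.
Qed.

(** The transformation law of Christoffel symbols; the inverse of the differential of [Phi] at [p]
    is written as the differential of [F] at [Phi p]. *)
Definition pullback_connection (R : realType) (V W : normedModType R)
    (Phi : V -> W) (F : W -> V) (Gam : W -> W -> W -> W) (p v w : V) : V :=
  'D_('D_v (fun q => 'D_w Phi q) p + Gam (Phi p) ('D_v Phi p) ('D_w Phi p))
    F (Phi p).

(** Differentiates [F (Phi q) = q]. With the roles exchanged it gives the other inverse, and it is
    the way in which injectivity of the differential of [Phi] is used below. *)
Lemma derive_cancel (R : realType) (V W : normedModType R)
    (Phi : V -> W) (F : W -> V) : elementary_map Phi -> elementary_map F ->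
  cancel Phi F -> forall p v, 'D_('D_v Phi p) F (Phi p) = v.
Proof.
move=> P0 F0 K p v; rewrite -elementary_map_chain //.
have -> : (fun q => F (Phi q)) = id by apply/funext.
exact: derive_id.
Qed.

Lemma pullback_connectionP (R : realType) (V W : normedModType R)
    (Phi : V -> W) (F : W -> V) (Gam : W -> W -> W -> W) p v w :
  elementary_map Phi -> elementary_map F -> cancel Phi F -> cancel F Phi ->
  'D_(pullback_connection Phi F Gam p v w) Phi p =
  'D_v (fun q => 'D_w Phi q) p + Gam (Phi p) ('D_v Phi p) ('D_w Phi p).
Proof.
move=> P0 F0 PK FK; rewrite /pullback_connection.
set x := (_ + _); rewrite -[X in 'D__ Phi X]PK.
exact: derive_cancel.
Qed.

(* [c] is a geodesic in the transport of geodesics, and the identity in the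
   transport of the curvature tensor. *)
Lemma pullback_connection_along (R : realType) (U V W : normedModType R)
    (Phi : V -> W) (F : W -> V) (Gam : W -> W -> W -> W) (c Y : U -> V) u a :
  elementary_map Phi -> elementary_map F -> cancel Phi F -> cancel F Phi ->
  elementary_map c -> elementary_map Y ->
  'D_('D_a Y u + pullback_connection Phi F Gam (c u) ('D_a c u) (Y u))
     Phi (c u) =
  'D_a (fun x => 'D_(Y x) Phi (c x)) u
  + Gam (Phi (c u)) ('D_('D_a c u) Phi (c u)) ('D_(Y u) Phi (c u)).
Proof.
move=> P0 F0 PK FK c0 Y0.
have lin q := elementary_map_derive_linear q P0.
have eA w := elementary_map_comp (elementary_mapD1 w P0) c0.
have [_ ->] := elementary_map_leibniz (fun x => lin (c x)) eA Y0.
rewrite (elementary_map_chain u a (elementary_mapD1 (Y u) P0) c0).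
rewrite -[X in 'D_(X + _) _ _]scale1r (lin (c u) 1) scale1r pullback_connectionP //.
by rewrite addrCA addrA.
Qed.

Lemma pullback_connection_elementary (R : realType) (V W : normedModType R)
    (Phi : V -> W) (F : W -> V) (Gam : W -> W -> W -> W) v w :
  elementary_map Phi -> elementary_map F -> trilinear Gam ->
  elementary_map (fun p => pullback_connection Phi F Gam p v w).
Proof.
move=> P0 F0 tG.
have eA e := elementary_map_comp (elementary_mapD1 e F0) P0.
apply: (elementary_map_leibniz (fun q => elementary_map_derive_linear (Phi q) F0) eA _).1.
apply: elementary_mapD.
  exact/elementary_mapD1/elementary_mapD1.
by apply: (elementary_map_trilin tG P0 _ _).1; exact: elementary_mapD1.
Qed.

Lemma derive_sub (R : realType) (V W : normedModType R) (F : V -> W) p v w :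
  elementary_map F -> 'D_(v - w) F p = 'D_v F p - 'D_w F p.
Proof.
move=> F0; have := elementary_map_derive_linear p F0 (-1) w v.
by rewrite !scaleN1r [v - w]addrC => ->; rewrite addrC.
Qed.

Lemma derive_opp (R : realType) (V W : normedModType R) (F : V -> W) p v :
  elementary_map F -> 'D_(- v) F p = - 'D_v F p.
Proof.
move=> F0; have := elementary_map_derive_linear p F0 (-1) v 0.
by rewrite !scaleN1r addr0 => ->; rewrite derive0 addr0.
Qed.

(** Since [Gam] is linear in the base point, its derivative in direction [x] is [Gam x]; the
    hypothesis on [K] is therefore the curvature formula of [Gam], with a value independent of the
    base point. All terms with second or third derivatives of [Phi] are symmetric in [v] and [w] and
    disappear in the difference. *)
Lemma curvature_pullback (R : realType) (V W : normedModType R)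
    (Phi : V -> W) (F : W -> V) (Gam K : W -> W -> W -> W) p v w z :
  elementary_map Phi -> elementary_map F -> cancel Phi F -> cancel F Phi ->
  elementary_map (@id V) ->
  trilinear Gam -> (forall q x y, Gam q x y = Gam q y x) ->
  (forall q x y t, Gam x y t - Gam y x t
     + Gam q x (Gam q y t) - Gam q y (Gam q x t) = K x y t) ->
  'D_(curvature (pullback_connection Phi F Gam) p v w z) Phi p =
  K ('D_v Phi p) ('D_w Phi p) ('D_z Phi p).
Proof.
move=> P0 F0 PK FK idV tG sG KE.
set G := pullback_connection Phi F Gam.
have eG x y : elementary_map (fun q => G q x y).
  exact: pullback_connection_elementary.
(* The image under [Phi] of the second covariant derivative of the constant field [z]. Constant
   fields commute, so the curvature is its antisymmetrization. *)
have cov x y : 'D_('D_x (fun q => G q y z) p + G p x (G p y z)) Phi p =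
    'D_x (fun q => 'D_y (fun r => 'D_z Phi r) q) p
    + (Gam ('D_x Phi p) ('D_y Phi p) ('D_z Phi p)
       + Gam (Phi p) ('D_x (fun q => 'D_y Phi q) p) ('D_z Phi p)
       + Gam (Phi p) ('D_y Phi p) ('D_x (fun q => 'D_z Phi q) p))
    + (Gam (Phi p) ('D_x Phi p) ('D_y (fun q => 'D_z Phi q) p)
       + Gam (Phi p) ('D_x Phi p) (Gam (Phi p) ('D_y Phi p) ('D_z Phi p))).
  have := pullback_connection_along Gam p x P0 F0 PK FK idV (eG y z).
  rewrite derive_id -/G => ->.
  have -> : (fun q => 'D_(G q y z) Phi q) = fun q =>
      'D_y (fun r => 'D_z Phi r) q + Gam (Phi q) ('D_y Phi q) ('D_z Phi q).
    by apply/funext => q; exact: pullback_connectionP.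
  have [e3 D3] := elementary_map_trilin tG P0 (elementary_mapD1 y P0)
                    (elementary_mapD1 z P0).
  have eD2 := elementary_mapD1 y (elementary_mapD1 z P0).
  rewrite (elementary_map_deriveD p x eD2 e3) D3 pullback_connectionP //.
  have [l3 _ _] := tG.
  by have := l3 (Phi p) ('D_x Phi p) 1; rewrite /= => l; rewrite -[X in Gam _ _ (X + _)]scale1r l scale1r.
have -> : curvature G p v w z = ('D_v (fun q => G q w z) p + G p v (G p w z))
    - ('D_w (fun q => G q v z) p + G p w (G p v z)).
  by rewrite /curvature opprD addrACA addrA.
rewrite (derive_sub _ _ _ P0).
etransitivity; first exact: (congr2 (fun x y => x - y) (cov v w) (cov w v)).
rewrite -(KE (Phi p)).
rewrite (elementary_map_schwarz p w v (elementary_mapD1 z P0)).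
rewrite (elementary_map_schwarz p w v P0).
set a := 'D_v _ p; set x1 := Gam _ _ _; set b := Gam _ _ _; set c := Gam _ _ _.
set d := Gam _ _ _; set y1 := Gam _ _ _; set x2 := Gam _ _ _; set y2 := Gam _ _ _.
have E (x y e f : W) : a + (x + b + e) + (f + y) = (a + b + (e + f)) + (x + y).
  by rewrite !addrA [LHS](ACl (1*3*4*5*2*6)).
by rewrite (E x1 y1 c d) (E x2 y2 d c) [d + c]addrC opprD addrACA subrr add0r opprD addrACA addrA.
Qed.

(** As [K] has constant coefficients, parallelism on the side of [W] is the purely algebraic last
    hypothesis. Differentiating the arguments ['D_v Phi] of [K] produces second derivatives of
    [Phi], which cancel against those in the transformation law. *)
Lemma nabla_curvature_pullback (R : realType) (V W : normedModType R)
    (Phi : V -> W) (F : W -> V) (Gam K : W -> W -> W -> W) :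
  elementary_map Phi -> elementary_map F -> cancel Phi F -> cancel F Phi ->
  elementary_map (@id V) ->
  trilinear Gam -> (forall q x y, Gam q x y = Gam q y x) -> trilinear K ->
  (forall q x y t, Gam x y t - Gam y x t
     + Gam q x (Gam q y t) - Gam q y (Gam q x t) = K x y t) ->
  (forall q a x y t, Gam q a (K x y t) - K (Gam q a x) y t
     - K x (Gam q a y) t - K x y (Gam q a t) = 0) ->
  forall p a v w z,
    nabla_curvature (pullback_connection Phi F Gam) p a v w z = 0.
Proof.
move=> P0 F0 PK FK idV tG sG tK KE PE p a v w z.
set G := pullback_connection Phi F Gam.
have JE q x y t : 'D_(curvature G q x y t) Phi q =
    K ('D_x Phi q) ('D_y Phi q) ('D_t Phi q).
  exact: curvature_pullback.
pose Y q := curvature G q v w z.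
have eJ x := elementary_mapD1 x P0.
have [eK DK] := elementary_map_trilin tK (eJ v) (eJ w) (eJ z).
have eY : elementary_map Y.
  have -> : Y = fun q =>
      'D_(K ('D_v Phi q) ('D_w Phi q) ('D_z Phi q)) F (Phi q).
    by apply/funext => q; rewrite -JE derive_cancel.
  have eA e := elementary_map_comp (elementary_mapD1 e F0) P0.
  exact: (elementary_map_leibniz
    (fun q => elementary_map_derive_linear (Phi q) F0) eA eK).1.
(* It suffices that the image under the differential of [Phi] vanishes. *)
rewrite -[LHS](derive_cancel P0 F0 PK p) /nabla_curvature -/G -/(Y p) -/Y.
have -> : 'D_('D_a Y p + G p a (Y p) - curvature G p (G p a v) w z
  - curvature G p v (G p a w) z - curvature G p v w (G p a z)) Phi p = 0;
  last exact: derive0.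
rewrite 3!(derive_sub _ _ _ P0).
have EY : 'D_('D_a Y p + G p a (Y p)) Phi p =
    K ('D_a (fun q => 'D_v Phi q) p) ('D_w Phi p) ('D_z Phi p)
    + K ('D_v Phi p) ('D_a (fun q => 'D_w Phi q) p) ('D_z Phi p)
    + K ('D_v Phi p) ('D_w Phi p) ('D_a (fun q => 'D_z Phi q) p)
    + Gam (Phi p) ('D_a Phi p) (K ('D_v Phi p) ('D_w Phi p) ('D_z Phi p)).
  have := pullback_connection_along Gam p a P0 F0 PK FK idV eY.
  rewrite derive_id => E; apply: (etrans E).
  have -> : (fun q => 'D_(Y q) Phi q) = fun q =>
      K ('D_v Phi q) ('D_w Phi q) ('D_z Phi q) by apply/funext => q; exact: JE.
  by rewrite DK /Y JE.
have EG x y := pullback_connectionP Gam p x y P0 F0 PK FK.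
etransitivity.
  apply: (congr2 (fun x y => x - y)).
    apply: (congr2 (fun x y => x - y)).
      apply: (congr2 (fun x y => x - y) EY).
      exact: (etrans (JE p (G p a v) w z)
                     (congr1 (fun x => K x _ _) (EG a v))).
    exact: (etrans (JE p v (G p a w) z) (congr1 (fun x => K _ x _) (EG a w))).
  exact: (etrans (JE p v w (G p a z)) (congr1 (fun x => K _ _ x) (EG a z))).
have [K3 K2 K1] := tK.
have K3D x y s t : K x y (s + t) = K x y s + K x y t.
  by have := K3 x y 1 s t; rewrite !scale1r.
have K2D x y s t : K x (s + t) y = K x s y + K x t y.
  by have := K2 x y 1 s t; rewrite !scale1r.
have K1D x y s t : K (s + t) x y = K s x y + K t x y.
  by have := K1 x y 1 s t; rewrite !scale1r.
rewrite K1D K2D K3D.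
set k1 := K _ _ _; set k2 := K _ _ _; set k3 := K _ _ _.
rewrite -[RHS](PE (Phi p) ('D_a Phi p) ('D_v Phi p) ('D_w Phi p) ('D_z Phi p)).
move: (Gam _ _ (K _ _ _)) (K (Gam _ _ _) _ _) (K _ (Gam _ _ _) _) (K _ _ (Gam _ _ _)).
move=> g g1 g2 g3.
rewrite !opprD !addrA.
rewrite (ACl (1*5*2*7*3*9*4*6*8*10)) /=.
by rewrite subrr add0r subrr add0r subrr add0r.
Qed.

(** Compatibility of [Gam] with [h] is asked along an arbitrary map [P], because the images
    ['D_v Phi] of constant fields are vector fields along [Phi] with varying coefficients. *)
Lemma levi_civita_pullback (R : realType) (V W : normedModType R)
    (Phi : V -> W) (F : W -> V) (Gam : W -> W -> W -> W)
    (h : W -> W -> W -> R) (g : V -> V -> V -> R) :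
  elementary_map Phi -> elementary_map F -> cancel Phi F -> cancel F Phi ->
  (forall q x y, Gam q x y = Gam q y x) ->
  (forall (P X Y : V -> W) p a,
     elementary_map P -> elementary_map X -> elementary_map Y ->
     'D_a (fun q => h (P q) (X q) (Y q)) p =
     h (P p) ('D_a X p + Gam (P p) ('D_a P p) (X p)) (Y p)
     + h (P p) (X p) ('D_a Y p + Gam (P p) ('D_a P p) (Y p))) ->
  (forall p v w, g p v w = h (Phi p) ('D_v Phi p) ('D_w Phi p)) ->
  is_levi_civita g (pullback_connection Phi F Gam).
Proof.
move=> P0 F0 PK FK sG hL gE; split=> [p v w|p a v w].
  rewrite /pullback_connection (sG (Phi p)).
  exact: (congr1 (fun x => 'D_(x + _) F (Phi p)) (elementary_map_schwarz p v w P0)).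
have EG x y := pullback_connectionP Gam p x y P0 F0 PK FK.
have gE1 x y z : g p (pullback_connection Phi F Gam p x y) z =
    h (Phi p) ('D_x (fun q => 'D_y Phi q) p
               + Gam (Phi p) ('D_x Phi p) ('D_y Phi p)) ('D_z Phi p).
  exact: (etrans (gE p _ z) (congr1 (fun X => h (Phi p) X _) (EG x y))).
have gE2 x y z : g p z (pullback_connection Phi F Gam p x y) =
    h (Phi p) ('D_z Phi p) ('D_x (fun q => 'D_y Phi q) p
               + Gam (Phi p) ('D_x Phi p) ('D_y Phi p)).
  exact: (etrans (gE p z _) (congr1 (fun X => h (Phi p) _ X) (EG x y))).
have -> : (fun q => g q v w) = fun q => h (Phi q) ('D_v Phi q) ('D_w Phi q).
  by apply/funext => q; exact: gE.
rewrite (gE1 a v w) (gE2 a w v).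
exact: (hL _ _ _ p a P0 (elementary_mapD1 v P0) (elementary_mapD1 w P0)).
Qed.

Lemma geodesic_pullback (R : realType) (V W : normedModType R)
    (Phi : V -> W) (F : W -> V) (Gam : W -> W -> W -> W) (c : R -> W) :
  elementary_map Phi -> elementary_map F -> cancel Phi F -> cancel F Phi ->
  elementary_map c ->
  (forall t, 'D_1 (fun r => 'D_1 c r) t + Gam (c t) ('D_1 c t) ('D_1 c t) = 0) ->
  is_geodesic (pullback_connection Phi F Gam) (fun t => F (c t)).
Proof.
move=> P0 F0 PK FK c0 cG t.
have e0 := elementary_map_comp F0 c0.
pose d := fun t => F (c t); rewrite -/d in e0 *.
have E1 : derive1 d = fun r => 'D_1 d r by apply/funext => r; exact: derive1E.
have e1 := elementary_mapD1 (1 : R) e0.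
have J : (fun r : R => 'D_('D_(1 : R) d r) Phi (d r)) = fun r => 'D_1 c r.
  apply/funext => r; rewrite -elementary_map_chain //; congr ('D_1 _ r).
  by apply/funext => x; exact: FK.
split; first exact: elementary_map_derivable.
  by rewrite E1; exact: elementary_map_derivable.
rewrite derive1E E1 -[LHS](derive_cancel P0 F0 PK (d t)).
rewrite (pullback_connection_along Gam t (1 : R) P0 F0 PK FK e0 e1) J.
have Jt : 'D_('D_(1 : R) d t) Phi (d t) = 'D_1 c t by exact: (congr1 (fun f => f t) J).
rewrite Jt [Phi (d t)]FK cG; exact: derive0.
Qed.

(** * Plane waves *)

(* Data of the metric 2 dt ds + Q(dz, dz) - Q(N z, z) dt^2 on a space with
   coordinates t, s and z: [wave_form] is Q, extended by 0 to the (t, s)-plane,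
   and [wave_op] is N.  [wave_sep] replaces a choice of coordinates for z. *)
Record wave_data (R : realType) (V : normedModType R) := WaveData {
  wave_t : {linear V -> R};
  wave_s : {linear V -> R};
  wave_em1 : V;
  wave_e0 : V;
  wave_form : V -> V -> R;
  wave_op : {linear V -> V};
  wave_formP : forall v, linear (wave_form v);
  wave_formC : forall v w, wave_form v w = wave_form w v;
  wave_opC : forall v w, wave_form (wave_op v) w = wave_form v (wave_op w);
  wave_t_em1 : wave_t wave_em1 = 1;
  wave_s_em1 : wave_s wave_em1 = 0;
  wave_t_e0 : wave_t wave_e0 = 0;
  wave_s_e0 : wave_s wave_e0 = 1;
  wave_form_em1 : forall v, wave_form v wave_em1 = 0;
  wave_form_e0 : forall v, wave_form v wave_e0 = 0;
  wave_op_em1 : wave_op wave_em1 = 0;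
  wave_op_e0 : wave_op wave_e0 = 0;
  wave_t_op : forall v, wave_t (wave_op v) = 0;
  wave_s_op : forall v, wave_s (wave_op v) = 0;
  wave_sep : forall v w, (forall l : {linear V -> R}, l v = l w) -> v = w;
  wave_nondeg : forall v, wave_t v = 0 -> wave_s v = 0 ->
    (forall w, wave_form v w = 0) -> v = 0
}.

Section PlaneWave.
Context (R : realType) (V : normedModType R) (D : wave_data V).
Implicit Types (p q v w : V).
Local Notation t := (wave_t D).
Local Notation s := (wave_s D).
Local Notation e0 := (wave_e0 D).
Local Notation em1 := (wave_em1 D).
Local Notation Q := (wave_form D).
Local Notation N := (wave_op D).

Definition wave_metric q v w : R :=
  t v * s w + s v * t w + Q v w - Q (N q) q * (t v * t w).

(** Encodes the geodesic equations t'' = 0, z'' = - (t')^2 N z and s'' = 2 t' Q(N z, z'). *)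
Definition wave_connection q v w : V :=
  - (t v * Q (N q) w + t w * Q (N q) v) *: e0 + (t v * t w) *: N q.

(* The value R(v, w) z of the curvature tensor, which has constant coefficients. *)
Definition wave_curvature v w z : V :=
  Q (N (t v *: w - t w *: v)) z *: e0 - t z *: N (t v *: w - t w *: v).

Let lD (l : {linear V -> R}) v w : l (v + w) = l v + l w.
Proof. exact: linearD. Qed.
Let lZ (l : {linear V -> R}) a v : l (a *: v) = a * l v.
Proof. exact: linearZ. Qed.
Let lN (l : {linear V -> R}) v : l (- v) = - l v.
Proof. exact: linearN. Qed.
Let QD v w z : Q z (v + w) = Q z v + Q z w.
Proof. by have := wave_formP D z 1 v w; rewrite !scale1r. Qed.
Let Q0 v : Q v 0 = 0.
Proof. by have := QD 0 0 v; rewrite addr0 => /eqP; rewrite eq_sym -subr_eq0 addrK => /eqP. Qed.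
Let QZ v w a : Q v (a *: w) = a * Q v w.
Proof. by have := wave_formP D v a w 0; rewrite Q0 !addr0. Qed.
Let QN v w : Q v (- w) = - Q v w.
Proof. by rewrite -scaleN1r QZ mulN1r. Qed.
Let QDl v w z : Q (v + w) z = Q v z + Q w z.
Proof. by rewrite !(wave_formC D _ z) QD. Qed.
Let QZl v w a : Q (a *: w) v = a * Q w v.
Proof. by rewrite !(wave_formC D _ v) QZ. Qed.
Let QNl v w : Q (- w) v = - Q w v.
Proof. by rewrite !(wave_formC D _ v) QN. Qed.
Let ND v w : N (v + w) = N v + N w.
Proof. exact: linearD. Qed.
Let NZ a v : N (a *: v) = a *: N v.
Proof. exact: linearZ. Qed.
Let NN v : N (- v) = - N v.
Proof. exact: linearN. Qed.
Let simpl_lin l := (lD l, lZ l, lN l).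
Let simpQ := (QD, QZ, QN, QDl, QZl, QNl).
Let simpN := (ND, NZ, NN).
Let simpe := (wave_t_em1 D, wave_s_em1 D, wave_t_e0 D, wave_s_e0 D,
  wave_form_em1 D, wave_form_e0 D).

Lemma wave_connection_trilinear : trilinear wave_connection.
Proof.
by split=> v w a x y; apply: (wave_sep D) => l;
  rewrite /wave_connection !(simpN, simpl_lin t, simpl_lin l, simpQ); ring.
Qed.

Lemma wave_connectionC q v w : wave_connection q v w = wave_connection q w v.
Proof. by rewrite /wave_connection [X in - X]addrC [t v * t w]mulrC. Qed.

Lemma wave_curvature_trilinear : trilinear wave_curvature.
Proof.
by split=> v w a x y; apply: (wave_sep D) => l;
  rewrite /wave_curvature !(simpN, simpl_lin t, simpl_lin l, simpQ); ring.
Qed.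

Let tG q v w : t (wave_connection q v w) = 0.
Proof.
by rewrite /wave_connection lD !lZ wave_t_e0 wave_t_op !mulr0 addr0.
Qed.

Let sG q v w :
  s (wave_connection q v w) = - (t v * Q (N q) w + t w * Q (N q) v).
Proof.
by rewrite /wave_connection lD !lZ wave_s_e0 wave_s_op mulr1 mulr0 addr0.
Qed.

Let NG q v w : N (wave_connection q v w) = (t v * t w) *: N (N q).
Proof. by rewrite /wave_connection ND !NZ wave_op_e0 scaler0 add0r. Qed.

Let QG q v w z : Q z (wave_connection q v w) = t v * t w * Q z (N q).
Proof. by rewrite /wave_connection QD !QZ wave_form_e0 mulr0 add0r. Qed.

Let GG q x y z : wave_connection q x (wave_connection q y z) =
  - (t x * (t y * t z * Q (N q) (N q))) *: e0.
Proof.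
by rewrite {1}/wave_connection tG QG !mul0r mulr0 scale0r !addr0.
Qed.

(** The terms quadratic in the Christoffel symbols are multiples of [e0] symmetric in [x] and [y].
    They cancel, and with them the dependence on [q]. *)
Lemma wave_curvatureE q x y z :
  wave_connection x y z - wave_connection y x z
  + wave_connection q x (wave_connection q y z)
  - wave_connection q y (wave_connection q x z) = wave_curvature x y z.
Proof.
rewrite !GG; apply: (wave_sep D) => l.
rewrite /wave_curvature /wave_connection ND NN !NZ QDl QNl !QZl.
rewrite !(simpl_lin l) (wave_opC D y x) (wave_formC D y (N x)); ring.
Qed.

(** The connection takes values in the kernel of [t]. Hence the terms where [a] acts on [x] and on
    [y] are opposite, both carrying the factor [t a * t x * t y], while the action on [z]
    compensates the action on the value by symmetry of [Q]. *)
Lemma wave_curvature_parallel q a x y z :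
  wave_connection q a (wave_curvature x y z)
  - wave_curvature (wave_connection q a x) y z
  - wave_curvature x (wave_connection q a y) z
  - wave_curvature x y (wave_connection q a z) = 0.
Proof.
have tK : t (wave_curvature x y z) = 0.
  by rewrite /wave_curvature lD lN !lZ wave_t_e0 wave_t_op !mulr0 subr0.
have QK : Q (N q) (wave_curvature x y z) =
    - (t z * Q (N q) (N (t x *: y - t y *: x))).
  by rewrite /wave_curvature QD QN !QZ wave_form_e0 mulr0 add0r.
rewrite {1}/wave_connection tK QK /wave_curvature !tG QG.
rewrite !(scale0r, mulr0, mul0r, addr0, sub0r, subr0, add0r).
rewrite !(NZ, NN, NG) (wave_formC D (N q)).
move: (N (t x *: y - t y *: x)) => o.
apply: (wave_sep D) => l; rewrite !(simpl_lin l, QZl, QNl); ring.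
Qed.

Lemma wave_metric_compatible (U : normedModType R) (P X Y : U -> V) (p a : U) :
  elementary_map P -> elementary_map X -> elementary_map Y ->
  'D_a (fun r => wave_metric (P r) (X r) (Y r)) p =
  wave_metric (P p) ('D_a X p + wave_connection (P p) ('D_a P p) (X p)) (Y p)
  + wave_metric (P p) (X p) ('D_a Y p + wave_connection (P p) ('D_a P p) (Y p)).
Proof.
move=> eP eX eY.
have dl (l : {linear V -> R}) (F : U -> V) : elementary_map F ->
    is_derive p a (fun r => l (F r)) (l ('D_a F p)).
  move=> eF; apply: DeriveDef; last exact: elementary_derive_linear.
  exact/elementary_map_derivable/elementary_map_linear.
have dQ (F G : U -> V) : elementary_map F -> elementary_map G ->
    is_derive p a (fun r => Q (F r) (G r)) (Q ('D_a F p) (G p) + Q (F p) ('D_a G p)).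
  move=> eF eG.
  have Ql w : linear (Q^~ w) by move=> b x y; rewrite QDl QZl.
  have [e E] := elementary_map_bilin (wave_formP D) Ql eF eG.
  by apply: DeriveDef; [exact: elementary_map_derivable|exact: E].
have eN := elementary_map_linear N eP.
have dtt : is_derive p a (fun r : U => t (X r) * t (Y r)) _ :=
  is_deriveM (dl t X eX) (dl t Y eY).
have := is_deriveB (is_deriveD (is_deriveD
   (is_deriveM (dl t X eX) (dl s Y eY)) (is_deriveM (dl s X eX) (dl t Y eY)))
   (dQ X Y eX eY))
  (is_deriveM (dQ _ P eN eP) dtt).
move=> /is_derive_val E; apply: (etrans E).
rewrite (elementary_derive_linear N p a eP).
move: (P p) ('D_a P p) (X p) ('D_a X p) (Y p) ('D_a Y p) => q q' x x' y y'.
move: (tG q q' x) (sG q q' x) (QG q q' x) (tG q q' y) (sG q q' y) (QG q q' y).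
move: (wave_connection q q' x) (wave_connection q q' y) => g h tg sg Qg th sh Qh.
rewrite /wave_metric !(lD t) !(lD s) tg sg th sh QD QDl (wave_formC D g y) Qg Qh.
rewrite (wave_opC D q' q) (wave_formC D q' (N q)) (wave_formC D y (N q)) (wave_formC D x (N q)).
rewrite -![_ *: _]/(_ * _); ring.
Qed.

Lemma wave_metricC q v w : wave_metric q v w = wave_metric q w v.
Proof. by rewrite /wave_metric (wave_formC D v); ring. Qed.

Lemma wave_metricP q a v v' w :
  wave_metric q (a *: v + v') w = a * wave_metric q v w + wave_metric q v' w.
Proof. by rewrite /wave_metric !(simpl_lin t, simpl_lin s, simpQ); ring. Qed.

Lemma wave_metric_nondeg q v : (forall w, wave_metric q v w = 0) -> v = 0.
Proof.
move=> H.
have tv : t v = 0.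
  by have := H e0; rewrite /wave_metric !simpe => <-; ring.
have sv : s v = 0.
  by have := H em1; rewrite /wave_metric !simpe tv => <-; ring.
apply: (@wave_nondeg _ _ D v tv sv) => w.
by rewrite -(H w) /wave_metric tv sv; ring.
Qed.

Lemma wave_metricN q v w : wave_metric (- q) (- v) (- w) = wave_metric q v w.
Proof.
by rewrite /wave_metric !(simpN, simpl_lin t, simpl_lin s, simpQ); ring.
Qed.

(* The s-component of a geodesic satisfies s'' = 2 b Q(N Z, Z'), and since
   Z'' = - b^2 N Z this is also - Q(Z, Z')'' / (2 b). *)
Lemma wave_geodesic (p v : V) (b : R) (Z Z1 : R -> V) :
  b = t v -> b != 0 -> elementary_map Z ->
  (forall r : R, is_derive r 1 Z (Z1 r)) ->
  (forall r : R, is_derive r 1 Z1 (- (b ^+ 2) *: N (Z r))) ->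
  (forall r, t (Z r) = 0) ->
  p = t p *: em1 + s p *: e0 + Z 0 -> v = t v *: em1 + s v *: e0 + Z1 0 ->
  exists c : R -> V, [/\ elementary_map c,
    forall r : R, 'D_1 (fun x => 'D_1 c x) r
      + wave_connection (c r) ('D_1 c r) ('D_1 c r) = 0,
    c 0 = p & 'D_1 c (0 : R) = v].
Proof.
move=> bE b0 eZ dZ dZ1 tZ pE vE.
have Z1E : (fun r : R => 'D_1 Z r) = Z1.
  by apply/funext => r; exact: is_derive_val.
have eZ1 : elementary_map Z1 by rewrite -Z1E; exact: elementary_mapD1.
have tZ1 r : t (Z1 r) = 0.
  rewrite -Z1E -elementary_derive_linear //.
  have -> : (fun x : R => t (Z x)) = cst 0 by apply/funext => x; exact: tZ.
  exact: derive_cst.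
have Ql w : linear (Q^~ w) by move=> a x y; rewrite QDl QZl.
have dQ (F G : R -> V) (r : R) F' G' : elementary_map F -> elementary_map G ->
    is_derive r 1 F F' -> is_derive r 1 G G' ->
    is_derive r 1 (fun x => Q (F x) (G x)) (Q F' (G r) + Q (F r) G').
  move=> eF eG dF dG.
  have [e E] := elementary_map_bilin (wave_formP D) Ql eF eG.
  rewrite -(is_derive_val dF) -(is_derive_val dG).
  by apply: DeriveDef; [exact: elementary_map_derivable|exact: E].
(* The integration constant for which [sg1 0 = s v]. The bracket is the derivative of
   [Q (Z r) (Z1 r)] at 0, after Z'' = - b^2 N Z. *)
pose k := s v + (2 * b)^-1 * (Q (Z1 0) (Z1 0) - b ^+ 2 * Q (N (Z 0)) (Z 0)).
pose sg r := s p + k * r - (2 * b)^-1 * (Q (Z r) (Z1 r) - Q (Z 0) (Z1 0)).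
pose sg1 r := k - (2 * b)^-1 * (Q (Z1 r) (Z1 r) - b ^+ 2 * Q (N (Z r)) (Z r)).
pose c r := (t p + b * r) *: em1 + sg r *: e0 + Z r.
pose c1 r := b *: em1 + sg1 r *: e0 + Z1 r.
have did (a : R) (r : R) : is_derive r 1 (fun x => a * x) a.
  have := is_deriveM (is_derive_cst a r 1) (is_derive_id r (1 : R)).
  by rewrite scaler0 addr0 [a *: 1]mulr1.
have dsg (r : R) : is_derive r 1 sg (sg1 r).
  have := is_deriveB (is_deriveD (is_derive_cst (s p) r 1) (did k r))
    (is_deriveZ (2 * b)^-1
      (is_deriveB (dQ _ _ r _ _ eZ eZ1 (dZ r) (dZ1 r)) (is_derive_cst (Q (Z 0) (Z1 0)) r 1))).
  move=> /is_derive_eq; apply; rewrite add0r subr0 /sg1.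
  by rewrite QZ (wave_opC D (Z r)) -![_ *: _]/(_ * _); ring.
have dNZ (r : R) : is_derive r 1 (fun x => N (Z x)) (N (Z1 r)).
  rewrite -Z1E -elementary_derive_linear //.
  exact/elementary_map_is_derive/elementary_map_linear.
have eNZ := elementary_map_linear N eZ.
have dsg1 (r : R) : is_derive r 1 sg1 (2 * b * Q (N (Z r)) (Z1 r)).
  have := is_deriveB (is_derive_cst k r 1) (is_deriveZ (2 * b)^-1
    (is_deriveB (dQ _ _ r _ _ eZ1 eZ1 (dZ1 r) (dZ1 r))
       (is_deriveZ (b ^+ 2) (dQ _ _ r _ _ eNZ eZ (dNZ r) (dZ r))))).
  move=> /is_derive_eq; apply; rewrite sub0r QZ QZl.
  rewrite (wave_opC D (Z1 r)) (wave_formC D (Z1 r) (N (Z r))).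
  rewrite -![_ *: _]/(_ * _); field.
  by rewrite b0.
have dc (r : R) : is_derive r 1 c (c1 r).
  apply: (is_deriveD (is_deriveD (is_deriveZl em1 _) (is_deriveZl e0 (dsg r))) (dZ r)).
  have := is_deriveD (is_derive_cst (t p) r 1) (did b r).
  by rewrite add0r.
have dc1 (r : R) : is_derive r 1 c1
    ((2 * b * Q (N (Z r)) (Z1 r)) *: e0 + - (b ^+ 2) *: N (Z r)).
  have := is_deriveD (is_deriveD (is_derive_cst (b *: em1) r 1) (is_deriveZl e0 (dsg1 r))) (dZ1 r).
  by rewrite add0r.
have c1E : (fun r : R => 'D_1 c r) = c1.
  by apply/funext => r; exact: is_derive_val.
have eid : elementary (fun r : R => r).
  by apply: (@elementary_linear _ _ (idfun : {linear R -> R})) => x.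
have emul a f : elementary f -> elementary (fun r : R => a * f r).
  by move=> ef; apply: (elementaryM (elementary_cst _ a)).
exists c; split.
- apply: elementary_mapD => //; apply: elementary_mapD; apply: elementary_mapZl.
    by apply: (elementaryD (elementary_cst _ (t p))); exact: emul.
  have eQ := elementary_map_scalar (elementary_map_bilin (wave_formP D) Ql eZ eZ1).1.
  apply: (@elementaryD _ _ (fun r => s p + k * r)).
    by apply: (elementaryD (elementary_cst _ (s p))); exact: emul.
  have -> : (fun r : R => - ((2 * b)^-1 * (Q (Z r) (Z1 r) - Q (Z 0) (Z1 0)))) =
     fun r => - (2 * b)^-1 * (Q (Z r) (Z1 r) + - Q (Z 0) (Z1 0)).
    by apply/funext => r; rewrite mulNr.
  by apply: emul; apply: elementaryD => //; exact: elementary_cst.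
- move=> r; rewrite c1E.
  rewrite (is_derive_val (dc1 r)).
  have -> : 'D_1 c r = c1 r by exact: is_derive_val.
  have tc1 : t (c1 r) = b.
    by rewrite /c1 !lD !lZ wave_t_em1 wave_t_e0 tZ1 mulr1 mulr0 !addr0.
  have Nc : N (c r) = N (Z r).
    by rewrite /c !ND !NZ wave_op_em1 wave_op_e0 !scaler0 !add0r.
  have Qc1 : Q (N (Z r)) (c1 r) = Q (N (Z r)) (Z1 r).
    by rewrite /c1 !QD !QZ wave_form_em1 wave_form_e0 !mulr0 !add0r.
  rewrite /wave_connection tc1 Nc Qc1.
  apply: (wave_sep D) => l; rewrite !(simpl_lin l); ring.
- rewrite /c /sg subrr mulr0 addr0 [k * 0]mulr0 mulr0 subr0 !addr0.
  exact/esym.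
- rewrite (is_derive_val (dc 0)) /c1 /sg1 /k addrK bE.
  exact/esym.
Qed.

(** The case b = 0, where one cannot divide by 2 b: the Christoffel symbols vanish on pairs of
    vectors tangent to the hyperplanes of constant t, so straight lines are geodesics. *)
Lemma wave_geodesic_line (p v : V) : t v = 0 ->
  exists c : R -> V, [/\ elementary_map c,
    forall r : R, 'D_1 (fun x => 'D_1 c x) r
      + wave_connection (c r) ('D_1 c r) ('D_1 c r) = 0,
    c 0 = p & 'D_1 c (0 : R) = v].
Proof.
move=> tv; pose c (r : R) := p + r *: v.
have eid : elementary (fun r : R => r).
  by apply: (@elementary_linear _ _ (idfun : {linear R -> R})) => x.
have dc (r : R) : is_derive r 1 c v.
  have := is_deriveD (is_derive_cst p r 1) (is_deriveZl v (is_derive_id r (1 : R))).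
  by rewrite add0r scale1r.
have c1E : (fun r : R => 'D_1 c r) = cst v.
  by apply/funext => r; exact: is_derive_val.
exists c; split.
- apply: elementary_mapD; first exact: elementary_map_cst.
  exact: elementary_mapZl.
- move=> r; rewrite c1E derive_cst (is_derive_val (dc r)) /wave_connection tv.
  by rewrite !mul0r addr0 oppr0 !scale0r !addr0.
- by rewrite /c scale0r addr0.
- exact: is_derive_val.
Qed.

End PlaneWave.

(** * Metrics carried to a plane wave by a global chart *)

Section WavePullback.
Context (R : realType) (V : normedModType R) (D : wave_data V).
Context (Phi F : V -> V) (g : V -> V -> V -> R).
Hypothesis P0 : elementary_map Phi.
Hypothesis F0 : elementary_map F.
Hypothesis PK : cancel Phi F.
Hypothesis FK : cancel F Phi.
Hypothesis gE : forall p v w,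
  g p v w = wave_metric D (Phi p) ('D_v Phi p) ('D_w Phi p).

Lemma wave_pullback_levi_civita :
  is_levi_civita g (pullback_connection Phi F (wave_connection D)).
Proof.
apply: (levi_civita_pullback P0 F0 PK FK _ _ gE).
- exact: wave_connectionC.
- by move=> P X Y p a; exact: wave_metric_compatible.
Qed.

Lemma wave_pullback_locally_symmetric :
  elementary_map (@id V) -> locally_symmetric g.
Proof.
move=> idV; exists (pullback_connection Phi F (wave_connection D)).
split; first exact: wave_pullback_levi_civita.
apply: (nabla_curvature_pullback P0 F0 PK FK idV).
- exact: wave_connection_trilinear.
- exact: wave_connectionC.
- exact: wave_curvature_trilinear.
- exact: wave_curvatureE.
- exact: wave_curvature_parallel.
Qed.

(** The hypothesis is the global solvability of Z'' = - b^2 N Z in the directions transverse to the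
    (t, s)-plane; it stays abstract because no eigenbasis of N is available at this level. *)
Lemma wave_pullback_complete :
  (forall (b : R) (z0 z1 : V), b != 0 ->
     wave_t D z0 = 0 -> wave_s D z0 = 0 -> wave_t D z1 = 0 -> wave_s D z1 = 0 ->
     exists Z Z1 : R -> V, [/\ elementary_map Z,
       forall r : R, is_derive r 1 Z (Z1 r),
       forall r : R, is_derive r 1 Z1 (- (b ^+ 2) *: wave_op D (Z r)),
       forall r, wave_t D (Z r) = 0 &
       Z 0 = z0 /\ Z1 0 = z1]) ->
  geodesically_complete g.
Proof.
move=> hZ; exists (pullback_connection Phi F (wave_connection D)).
split; first exact: wave_pullback_levi_civita.
move=> p v; set q := Phi p; set w := 'D_v Phi p.
suff [c [ec cG c0 c1]] : exists c : R -> V, [/\ elementary_map c,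
    forall r : R, 'D_1 (fun x => 'D_1 c x) r
      + wave_connection D (c r) ('D_1 c r) ('D_1 c r) = 0,
    c 0 = q & 'D_1 c (0 : R) = w].
  exists (fun r => F (c r)); split.
  - exact: geodesic_pullback.
  - by rewrite c0 PK.
  - rewrite derive1E (elementary_map_chain (0 : R) (1 : R) F0 ec) c0 c1.
    exact: derive_cancel.
have [tw|tw] := eqVneq (wave_t D w) 0; first exact: wave_geodesic_line.
(* Projection onto the common kernel of t and s, supplying the initial values of the oscillator. *)
pose pr x := x - wave_t D x *: wave_em1 D - wave_s D x *: wave_e0 D.
have lpr (l : {linear V -> R}) x : l (pr x) =
    l x - wave_t D x * l (wave_em1 D) - wave_s D x * l (wave_e0 D).
  by rewrite /pr !linearB !linearZ.
have pt x : wave_t D (pr x) = 0.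
  by rewrite lpr wave_t_em1 wave_t_e0 mulr1 mulr0 subrr subr0.
have ps x : wave_s D (pr x) = 0.
  by rewrite lpr wave_s_em1 wave_s_e0 mulr1 mulr0 subr0 subrr.
have prE x : x = wave_t D x *: wave_em1 D + wave_s D x *: wave_e0 D + pr x.
  have -> : pr x = x - (wave_t D x *: wave_em1 D + wave_s D x *: wave_e0 D).
    by rewrite opprD addrA.
  by rewrite addrC subrK.
have [Z [Z1 [eZ dZ dZ1 tZ [Z0E Z1E]]]] :=
  hZ _ (pr q) (pr w) tw (pt q) (ps q) (pt w) (ps w).
by apply: (wave_geodesic erefl tw eZ dZ dZ1 tZ); rewrite ?Z0E ?Z1E.
Qed.

Lemma wave_pullback_pseudo_riemannian : pseudo_riemannian g.
Proof.
split=> [v w|p v w|p a v v' w|p v H].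
- have -> : (fun p => g p v w) = fun p =>
      wave_metric D (Phi p) ('D_v Phi p) ('D_w Phi p).
    by apply/funext => p; exact: gE.
  have ev := elementary_mapD1 v P0; have ew := elementary_mapD1 w P0.
  have el (l : {linear V -> R}) (X : V -> V) : elementary_map X ->
      elementary (fun p => l (X p)).
    by move=> eX; exact/elementary_map_scalar/elementary_map_linear.
  have Ql x : linear ((wave_form D)^~ x).
    by move=> b y z; rewrite 3!(wave_formC D _ x) wave_formP.
  have eQ (X Y : V -> V) : elementary_map X -> elementary_map Y ->
      elementary (fun p => wave_form D (X p) (Y p)).
    move=> eX eY; apply: elementary_map_scalar.
    exact: (elementary_map_bilin (wave_formP D) Ql eX eY).1.
  apply/elementary_map_smooth/elementary_scalar_map.
  have -> : (fun p => wave_metric D (Phi p) ('D_v Phi p) ('D_w Phi p)) = fun p =>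
      wave_t D ('D_v Phi p) * wave_s D ('D_w Phi p)
      + wave_s D ('D_v Phi p) * wave_t D ('D_w Phi p)
      + wave_form D ('D_v Phi p) ('D_w Phi p)
      + (-1) * (wave_form D (wave_op D (Phi p)) (Phi p) *
         (wave_t D ('D_v Phi p) * wave_t D ('D_w Phi p))).
    by apply/funext => p; rewrite mulN1r.
  apply: elementaryD; last first.
    apply: (elementaryM (elementary_cst _ (-1))); apply: elementaryM.
      by apply: eQ => //; exact: elementary_map_linear.
    by apply: elementaryM; exact: el.
  apply: elementaryD; last exact: eQ.
  by apply: elementaryD; apply: elementaryM; exact: el.
- by rewrite !gE wave_metricC.
- rewrite !gE (elementary_map_derive_linear p P0 a v v'); exact: wave_metricP.
- have Jv : 'D_v Phi p = 0.
    apply: (@wave_metric_nondeg _ _ D (Phi p)) => w.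
    (* The differential of [Phi] maps this test vector to [w], so ['D_v Phi p] is orthogonal to
       everything. *)
    have := H ('D_w F (Phi p)); rewrite gE => E; apply: (etrans _ E).
    congr (wave_metric D _ _ _); apply/esym.
    by have := derive_cancel F0 P0 FK (Phi p) w; rewrite PK.
  by rewrite -(derive_cancel P0 F0 PK p v) Jv; exact: derive0.
Qed.

Definition wave_reflection (p : V) : V := F (- Phi p).

Lemma wave_reflection_elementary : elementary_map wave_reflection.
Proof.
apply: (elementary_map_comp F0).
have -> : (fun p => - Phi p) = fun p => (fun=> -1 : R) p *: Phi p.
  by apply/funext => p; rewrite scaleN1r.
by apply: elementary_mapZ => //; exact: elementary_cst.
Qed.

Lemma wave_reflection_derive p v :
  'D_('D_v wave_reflection p) Phi (wave_reflection p) = - 'D_v Phi p.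
Proof.
rewrite -(elementary_map_chain p v P0 wave_reflection_elementary).
have -> : (fun q => Phi (wave_reflection q)) = fun q => - Phi q.
  by apply/funext => q; rewrite /wave_reflection FK.
by apply: deriveN; exact: elementary_map_derivable.
Qed.

Lemma wave_reflection_isometry : is_isometry g wave_reflection.
Proof.
have K : cancel wave_reflection wave_reflection.
  by move=> p; rewrite /wave_reflection FK opprK PK.
have sm := elementary_map_smooth wave_reflection_elementary.
split=> // [|p v w]; first by exists wave_reflection.
rewrite !(elementary_map_diff _ _ wave_reflection_elementary) !gE.
have E x := wave_reflection_derive p x.
rewrite -(wave_metricN D (Phi p)).
have -> : Phi (wave_reflection p) = - Phi p by exact: FK.
exact: (congr2 (wave_metric D (- Phi p)) (E v) (E w)).
Qed.

(** The differential of [Phi] conjugates that of the reflection to - id. The hypothesis puts [Phi p]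
    at the fixed point of - id. *)
Lemma wave_reflection_fix p : Phi p = 0 ->
  wave_reflection p = p /\ forall v, 'D_v wave_reflection p = - v.
Proof.
move=> p0.
have fp : wave_reflection p = p by rewrite /wave_reflection p0 oppr0 -p0 PK.
split=> // v; have := wave_reflection_derive p v; rewrite fp => E.
rewrite -(derive_cancel P0 F0 PK p ('D_v wave_reflection p)).
apply: (etrans (congr1 (fun x => 'D_x F (Phi p)) E)).
rewrite -[RHS](derive_cancel P0 F0 PK p).
by congr ('D__ F _); rewrite (derive_opp _ _ P0).
Qed.

End WavePullback.

(** * Oscillator groups *)

Lemma osc_coord_eq (R : realType) (n : nat) (p q : osc R n) :
  osc_t p = osc_t q -> osc_s p = osc_s q ->
  (forall j, osc_x p j = osc_x q j) -> (forall j, osc_y p j = osc_y q j) ->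
  p = q.
Proof.
by move=> et es ex ey; apply: osc_eqP => // j; rewrite /osc_z ex ey.
Qed.

Lemma osc_tP (R : realType) (n : nat) : linear (@osc_t R n).
Proof. by []. Qed.
Lemma osc_sP (R : realType) (n : nat) : linear (@osc_s R n).
Proof. by []. Qed.
Lemma osc_xP (R : realType) (n : nat) j : linear ((@osc_x R n)^~ j).
Proof. by move=> a v w; rewrite /osc_x /= !mxE. Qed.
Lemma osc_yP (R : realType) (n : nat) j : linear ((@osc_y R n)^~ j).
Proof. by move=> a v w; rewrite /osc_y /= !mxE. Qed.

Lemma osc_tD (R : realType) (n : nat) (v w : osc R n) :
  osc_t (v + w) = osc_t v + osc_t w.
Proof. by []. Qed.
Lemma osc_sD (R : realType) (n : nat) (v w : osc R n) :
  osc_s (v + w) = osc_s v + osc_s w.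
Proof. by []. Qed.
Lemma osc_xD (R : realType) (n : nat) (v w : osc R n) j :
  osc_x (v + w) j = osc_x v j + osc_x w j.
Proof. by rewrite /osc_x /= !mxE. Qed.
Lemma osc_yD (R : realType) (n : nat) (v w : osc R n) j :
  osc_y (v + w) j = osc_y v j + osc_y w j.
Proof. by rewrite /osc_y /= !mxE. Qed.
Lemma osc_tZ (R : realType) (n : nat) a (v : osc R n) :
  osc_t (a *: v) = a * osc_t v.
Proof. by []. Qed.
Lemma osc_sZ (R : realType) (n : nat) a (v : osc R n) :
  osc_s (a *: v) = a * osc_s v.
Proof. by []. Qed.
Lemma osc_xZ (R : realType) (n : nat) a (v : osc R n) j :
  osc_x (a *: v) j = a * osc_x v j.
Proof. by rewrite /osc_x /= !mxE. Qed.
Lemma osc_yZ (R : realType) (n : nat) a (v : osc R n) j :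
  osc_y (a *: v) j = a * osc_y v j.
Proof. by rewrite /osc_y /= !mxE. Qed.
Lemma osc_tN (R : realType) (n : nat) (v : osc R n) : osc_t (- v) = - osc_t v.
Proof. by []. Qed.
Lemma osc_sN (R : realType) (n : nat) (v : osc R n) : osc_s (- v) = - osc_s v.
Proof. by []. Qed.
Lemma osc_xN (R : realType) (n : nat) (v : osc R n) j :
  osc_x (- v) j = - osc_x v j.
Proof. by rewrite /osc_x /= !mxE. Qed.
Lemma osc_yN (R : realType) (n : nat) (v : osc R n) j :
  osc_y (- v) j = - osc_y v j.
Proof. by rewrite /osc_y /= !mxE. Qed.

Definition osc_row (R : realType) (n : nat) (t s : R) (x y : 'I_n -> R) : osc R n :=
  ((t, s), (\row_j x j, \row_j y j)).

Lemma osc_t_row (R : realType) (n : nat) t s (x y : 'I_n -> R) :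
  osc_t (osc_row t s x y) = t.
Proof. by []. Qed.
Lemma osc_s_row (R : realType) (n : nat) t s (x y : 'I_n -> R) :
  osc_s (osc_row t s x y) = s.
Proof. by []. Qed.
Lemma osc_x_row (R : realType) (n : nat) t s (x y : 'I_n -> R) j :
  osc_x (osc_row t s x y) j = x j.
Proof. by rewrite /osc_x /= mxE. Qed.
Lemma osc_y_row (R : realType) (n : nat) t s (x y : 'I_n -> R) j :
  osc_y (osc_row t s x y) j = y j.
Proof. by rewrite /osc_y /= mxE. Qed.

Lemma osc_row_basis (R : realType) (n : nat) :
  (osc_em1 R n = osc_row 1 0 (fun=> 0) (fun=> 0)) *
  (osc_e0 R n = osc_row 0 1 (fun=> 0) (fun=> 0)) *
  (0 = osc_row 0 0 (fun=> 0) (fun=> 0) :> osc R n).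
Proof.
by do !split; apply: osc_coord_eq => // j;
  rewrite ?osc_x_row ?osc_y_row /osc_x /osc_y /= mxE.
Qed.

Definition osc_simp (R : realType) (n : nat) :=
  (@osc_row_basis R n, (@osc_tD R n, @osc_sD R n, @osc_xD R n, @osc_yD R n),
   (@osc_tZ R n, @osc_sZ R n, @osc_xZ R n, @osc_yZ R n),
   (@osc_tN R n, @osc_sN R n, @osc_xN R n, @osc_yN R n),
   (@osc_t_row R n, @osc_s_row R n, @osc_x_row R n, @osc_y_row R n)).

Lemma osc_linear_elementary (R : realType) (n : nat) (l : osc R n -> R) :
  linear l -> elementary l.
Proof.
move=> ll; pose M := GRing.isLinear.Build _ _ _ _ _ ll.
pose L : {linear osc R n -> R} := HB.pack l M.
apply: (@elementary_linear _ _ L); exact: osc_linear_continuous.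
Qed.

Lemma osc_map_elementary (R : realType) (n : nat) (V : normedModType R)
    (F : V -> osc R n) :
  elementary (fun p => osc_t (F p)) -> elementary (fun p => osc_s (F p)) ->
  (forall j, elementary (fun p => osc_x (F p) j)) ->
  (forall j, elementary (fun p => osc_y (F p) j)) -> elementary_map F.
Proof.
move=> et es ex ey.
have -> : F = fun p => osc_t (F p) *: osc_em1 R n + osc_s (F p) *: osc_e0 R n
    + \sum_j osc_x (F p) j *: osc_e R j + \sum_j osc_y (F p) j *: osc_ec R j.
  by apply/funext => p; exact: osc_basis_sum.
do !apply: elementary_mapD; try exact: elementary_mapZl.
  by apply: elementary_map_sum => j; exact: elementary_mapZl.
by apply: elementary_map_sum => j; exact: elementary_mapZl.
Qed.

Lemma osc_id_elementary (R : realType) (n : nat) :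
  elementary_map (fun p : osc R n => p).
Proof.
apply: osc_map_elementary => [||j|j]; apply: osc_linear_elementary.
- exact: osc_tP.
- exact: osc_sP.
- exact: osc_xP.
- exact: osc_yP.
Qed.

Lemma osc_coord_derive (R : realType) (n : nat) (V : normedModType R)
    (F : V -> osc R n) p v : elementary_map F ->
  [/\ osc_t ('D_v F p) = 'D_v (fun q => osc_t (F q)) p,
      osc_s ('D_v F p) = 'D_v (fun q => osc_s (F q)) p,
      forall j, osc_x ('D_v F p) j = 'D_v (fun q => osc_x (F q) j) p &
      forall j, osc_y ('D_v F p) j = 'D_v (fun q => osc_y (F q) j) p].
Proof.
move=> F0; split=> [||j|j].
- by have [_ ->] := elementary_map_lin (@osc_tP R n) F0.
- by have [_ ->] := elementary_map_lin (@osc_sP R n) F0.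
- by have [_ ->] := elementary_map_lin (@osc_xP R n j) F0.
- by have [_ ->] := elementary_map_lin (@osc_yP R n j) F0.
Qed.


(** * Plane waves on the vector space underlying the oscillator group *)

Section OscWave.
Context (R : realType) (n : nat) (A B nu : 'I_n -> R).
Implicit Types (p q v w : osc R n).

Definition osc_form v w : R :=
  \sum_j (A j * (osc_x v j * osc_x w j) + B j * (osc_y v j * osc_y w j)).

(** One frequency serves both real coordinates of z_j, even in case (a) where [A j] and [B j] may
    differ; so the operator is self-adjoint for all [A] and [B]. *)
Definition osc_op v : osc R n :=
  osc_row 0 0 (fun j => nu j ^+ 2 * osc_x v j) (fun j => nu j ^+ 2 * osc_y v j).

Lemma osc_formC v w : osc_form v w = osc_form w v.
Proof. by apply: eq_bigr => j _; ring. Qed.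

Lemma osc_formP v : linear (osc_form v).
Proof.
move=> a w z; rewrite /osc_form -[X in _ = X + _]/(a * _) mulr_sumr -big_split.
by apply: eq_bigr => j _; rewrite !osc_simp /=; ring.
Qed.

Lemma osc_opP : linear osc_op.
Proof.
move=> a v w; apply: osc_coord_eq => [||j|j]; rewrite /osc_op !osc_simp; ring.
Qed.

Lemma osc_opC v w : osc_form (osc_op v) w = osc_form v (osc_op w).
Proof. by apply: eq_bigr => j _; rewrite !osc_simp; ring. Qed.

Lemma osc_form_em1 v : osc_form v (osc_em1 R n) = 0.
Proof. by apply: big1 => j _; rewrite !osc_simp; ring. Qed.

Lemma osc_form_e0 v : osc_form v (osc_e0 R n) = 0.
Proof. by apply: big1 => j _; rewrite !osc_simp; ring. Qed.

Lemma osc_op_em1 : osc_op (osc_em1 R n) = 0.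
Proof.
by apply: osc_coord_eq => [||j|j]; rewrite /osc_op !osc_simp; ring.
Qed.

Lemma osc_op_e0 : osc_op (osc_e0 R n) = 0.
Proof.
by apply: osc_coord_eq => [||j|j]; rewrite /osc_op !osc_simp; ring.
Qed.

Lemma osc_sep v w : (forall l : {linear osc R n -> R}, l v = l w) -> v = w.
Proof.
move=> H.
have L (l : osc R n -> R) : linear l -> l v = l w.
  move=> ll; pose M := GRing.isLinear.Build _ _ _ _ _ ll.
  exact: (H (HB.pack l M)).
apply: osc_coord_eq => [||j|j].
- exact: (L _ (@osc_tP R n)).
- exact: (L _ (@osc_sP R n)).
- exact: (L _ (@osc_xP R n j)).
- exact: (L _ (@osc_yP R n j)).
Qed.

Lemma osc_xy_e (i j : 'I_n) : (osc_x (osc_e R i) j = (j == i)%:R) *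
  (osc_y (osc_e R i) j = 0) * (osc_x (osc_ec R i) j = 0) *
  (osc_y (osc_ec R i) j = (j == i)%:R).
Proof. by rewrite /osc_x /osc_y /= !mxE eqxx. Qed.

Lemma osc_form_e v i : osc_form v (osc_e R i) = A i * osc_x v i.
Proof.
rewrite /osc_form (bigD1 i) //= big1 => [|j ji].
  by rewrite !osc_xy_e eqxx /=; ring.
by rewrite !osc_xy_e (negbTE ji) /=; ring.
Qed.

Lemma osc_form_ec v i : osc_form v (osc_ec R i) = B i * osc_y v i.
Proof.
rewrite /osc_form (bigD1 i) //= big1 => [|j ji].
  by rewrite !osc_xy_e eqxx /=; ring.
by rewrite !osc_xy_e (negbTE ji) /=; ring.
Qed.

Hypothesis A0 : forall j, A j != 0.
Hypothesis B0 : forall j, B j != 0.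

Lemma osc_form_nondeg v : osc_t v = 0 -> osc_s v = 0 ->
  (forall w, osc_form v w = 0) -> v = 0.
Proof.
move=> tv sv H; apply: osc_coord_eq => // j; rewrite !osc_simp.
- have /eqP := H (osc_e R j); rewrite osc_form_e mulf_eq0 (negbTE (A0 j)).
  by move=> /eqP.
- have /eqP := H (osc_ec R j); rewrite osc_form_ec mulf_eq0 (negbTE (B0 j)).
  by move=> /eqP.
Qed.

(** Kept transparent: the comparison with [kmetric] computes through the projections of this
    record. *)
Definition osc_wave_data : wave_data (osc R n).
Proof.
pose Mt := GRing.isLinear.Build _ _ _ _ _ (@osc_tP R n).
pose Ms := GRing.isLinear.Build _ _ _ _ _ (@osc_sP R n).
pose Mo := GRing.isLinear.Build _ _ _ _ _ osc_opP.
pose t : {linear osc R n -> R} := HB.pack (@osc_t R n) Mt.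
pose s : {linear osc R n -> R} := HB.pack (@osc_s R n) Ms.
pose o : {linear osc R n -> osc R n} := HB.pack osc_op Mo.
by apply: (@WaveData _ _ t s (osc_em1 R n) (osc_e0 R n) osc_form o
  osc_formP osc_formC osc_opC erefl erefl erefl erefl osc_form_em1
  osc_form_e0 osc_op_em1 osc_op_e0 _ _ osc_sep osc_form_nondeg).
Defined.

Hypothesis nu0 : forall j, nu j != 0.

Lemma osc_oscillator (b : R) (z0 z1 : osc R n) : b != 0 ->
  osc_t z0 = 0 -> osc_s z0 = 0 -> osc_t z1 = 0 -> osc_s z1 = 0 ->
  exists Z Z1 : R -> osc R n, [/\ elementary_map Z,
    forall r : R, is_derive r 1 Z (Z1 r),
    forall r : R, is_derive r 1 Z1 (- (b ^+ 2) *: osc_op (Z r)),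
    forall r, osc_t (Z r) = 0 &
    Z 0 = z0 /\ Z1 0 = z1].
Proof.
move=> b0 t0 s0 t1 s1.
pose th j := nu j * b.
have th0 j : th j != 0 by rewrite mulf_neq0.
pose f (a c k r : R) := a * cos (k * r) + c * sin (k * r).
have ef a c k : elementary (f a c k).
  have el : elementary (fun r : R => k * r).
    apply: (elementaryM (elementary_cst _ k)).
    by apply: (@elementary_linear _ _ (idfun : {linear R -> R})) => x.
  by apply: elementaryD; apply: (elementaryM (elementary_cst _ _));
    [exact: elementary_cos|exact: elementary_sin].
have df a c k (r : R) : is_derive r 1 (f a c k) (f (k * c) (- (k * a)) k r).
  have dk : is_derive r 1 (fun x => k * x) k.
    have := is_deriveZ k (is_derive_id r (1 : R)).
    by rewrite [k *: 1]mulr1.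
  have dc := @is_derive1_comp _ cos (fun x => k * x) r _ _ (is_derive_cos _) dk.
  have ds := @is_derive1_comp _ sin (fun x => k * x) r _ _ (is_derive_sin _) dk.
  have := is_deriveD (is_deriveZ a dc) (is_deriveZ c ds).
  move=> /is_derive_eq; apply; rewrite /f -![_ *: _]/(_ * _); ring.
(* This family is closed under differentiation, so a single formula gives both the first and the
   second derivative. *)
pose W (a c d e : 'I_n -> R) (r : R) : osc R n :=
  osc_row 0 0 (fun j => f (a j) (c j) (th j) r) (fun j => f (d j) (e j) (th j) r).
have Wx a c d e j : (fun r => osc_x (W a c d e r) j) = f (a j) (c j) (th j).
  by apply/funext => r; rewrite osc_x_row.
have Wy a c d e j : (fun r => osc_y (W a c d e r) j) = f (d j) (e j) (th j).
  by apply/funext => r; rewrite osc_y_row.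
have eW a c d e : elementary_map (W a c d e).
  apply: osc_map_elementary => [||j|j].
  - exact: elementary_cst.
  - exact: elementary_cst.
  - by rewrite Wx.
  - by rewrite Wy.
have dW a c d e (r : R) : is_derive r 1 (W a c d e)
   (W (fun j => th j * c j) (fun j => - (th j * a j))
      (fun j => th j * e j) (fun j => - (th j * d j)) r).
  apply: DeriveDef; first exact: elementary_map_derivable.
  have [E1 E2 E3 E4] := osc_coord_derive r 1 (eW a c d e).
  apply: osc_coord_eq => [||j|j].
  - by rewrite E1; exact: derive_cst.
  - by rewrite E2; exact: derive_cst.
  - by rewrite E3 Wx osc_x_row; exact: is_derive_val.
  - by rewrite E4 Wy osc_y_row; exact: is_derive_val.
pose a := osc_x z0; pose d := osc_y z0.
(* Differentiation multiplies the sine coefficients by the angular frequency [th j]; dividing by it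
   here makes [z1] the initial velocity. *)
pose c j := osc_x z1 j / th j; pose e j := osc_y z1 j / th j.
exists (W a c d e), (W (fun j => th j * c j) (fun j => - (th j * a j))
      (fun j => th j * e j) (fun j => - (th j * d j))); split=> //.
- move=> r; have := dW (fun j => th j * c j) (fun j => - (th j * a j))
      (fun j => th j * e j) (fun j => - (th j * d j)) r.
  move=> /is_derive_eq; apply; rewrite /W /osc_op /f.
  by apply: osc_coord_eq => [||j|j]; rewrite !osc_simp /th; ring.
- rewrite /W /f; split; apply: osc_coord_eq => [||j|j] //;
    rewrite !osc_simp mulr0 cos0 sin0 mulr0 addr0 mulr1 //;
    by rewrite /c /e mulrCA divff // mulr1.
Qed.

End OscWave.

(** * Rotating coordinates on the oscillator group *)

Section OscChart.
Context (R : realType) (n : nat) (nu c : 'I_n -> R) (k : R).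
Implicit Types (p q v w : osc R n).

Definition chart_x p j :=
  cos (nu j * osc_t p) * osc_x p j + sin (nu j * osc_t p) * osc_y p j.
Definition chart_y p j :=
  cos (nu j * osc_t p) * osc_y p j - sin (nu j * osc_t p) * osc_x p j.

Definition osc_chart p : osc R n :=
  osc_row (osc_t p)
    (osc_s p + k * osc_t p + \sum_j c j * (chart_x p j * chart_y p j))
    (chart_x p) (chart_y p).

Definition osc_unchart q : osc R n :=
  osc_row (osc_t q)
    (osc_s q - k * osc_t q - \sum_j c j * (osc_x q j * osc_y q j))
    (fun j => cos (nu j * osc_t q) * osc_x q j - sin (nu j * osc_t q) * osc_y q j)
    (fun j => cos (nu j * osc_t q) * osc_y q j + sin (nu j * osc_t q) * osc_x q j).

Lemma osc_chartK : cancel osc_chart osc_unchart.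
Proof.
move=> p; apply: osc_coord_eq => [//||j|j];
  rewrite /osc_unchart /osc_chart !(osc_s_row, osc_x_row, osc_y_row) ?osc_t_row.
- under [X in _ - X]eq_bigr => j _ do rewrite osc_x_row osc_y_row.
  by ring.
- rewrite /chart_x /chart_y; have := cos2Dsin2 (nu j * osc_t p).
  set C := cos _; set S := sin _ => h.
  have {}h : S ^+ 2 = 1 - C ^+ 2 by rewrite -h; ring.
  by ring: h.
- rewrite /chart_x /chart_y; have := cos2Dsin2 (nu j * osc_t p).
  set C := cos _; set S := sin _ => h.
  have {}h : S ^+ 2 = 1 - C ^+ 2 by rewrite -h; ring.
  by ring: h.
Qed.

Lemma osc_unchartK : cancel osc_unchart osc_chart.
Proof.
move=> q.
have Ex j : chart_x (osc_unchart q) j = osc_x q j.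
  rewrite /chart_x /osc_unchart osc_t_row osc_x_row osc_y_row.
  have := cos2Dsin2 (nu j * osc_t q).
  set C := cos _; set S := sin _ => h.
  have {}h : S ^+ 2 = 1 - C ^+ 2 by rewrite -h; ring.
  by ring: h.
have Ey j : chart_y (osc_unchart q) j = osc_y q j.
  rewrite /chart_y /osc_unchart osc_t_row osc_x_row osc_y_row.
  have := cos2Dsin2 (nu j * osc_t q).
  set C := cos _; set S := sin _ => h.
  have {}h : S ^+ 2 = 1 - C ^+ 2 by rewrite -h; ring.
  by ring: h.
apply: osc_coord_eq => [//||j|j].
- rewrite /osc_chart osc_s_row.
  under eq_bigr => j _ do rewrite Ex Ey.
  by rewrite /osc_unchart osc_s_row osc_t_row; ring.
- by rewrite osc_x_row Ex.
- by rewrite osc_y_row Ey.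
Qed.

Let elem_t : elementary (@osc_t R n).
Proof. exact/osc_linear_elementary/osc_tP. Qed.
Let elem_s : elementary (@osc_s R n).
Proof. exact/osc_linear_elementary/osc_sP. Qed.
Let elem_x j : elementary (fun p => osc_x p j).
Proof. exact/osc_linear_elementary/osc_xP. Qed.
Let elem_y j : elementary (fun p => osc_y p j).
Proof. exact/osc_linear_elementary/osc_yP. Qed.
Let elem_M a f : elementary f -> elementary (fun p => a * f p).
Proof. by move=> f0; apply: (elementaryM (elementary_cst _ a)). Qed.

Lemma chart_x_elementary j : elementary (fun p => chart_x p j).
Proof.
apply: elementaryD; apply: elementaryM => //.
  exact/elementary_cos/elem_M.
exact/elementary_sin/elem_M.
Qed.

Lemma chart_y_elementary j : elementary (fun p => chart_y p j).
Proof.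
apply: elementaryB; apply: elementaryM => //.
  exact/elementary_cos/elem_M.
exact/elementary_sin/elem_M.
Qed.

Lemma osc_chart_elementary : elementary_map osc_chart.
Proof.
apply: osc_map_elementary => [||j|j].
- exact: elem_t.
- apply: elementaryD.
    by apply: elementaryD => //; exact: elem_M.
  apply: elementary_sum => j; apply: elem_M.
  by apply: elementaryM; [exact: chart_x_elementary|exact: chart_y_elementary].
- have -> : (fun p => osc_x (osc_chart p) j) = fun p => chart_x p j.
    by apply/funext => p; rewrite osc_x_row.
  exact: chart_x_elementary.
- have -> : (fun p => osc_y (osc_chart p) j) = fun p => chart_y p j.
    by apply/funext => p; rewrite osc_y_row.
  exact: chart_y_elementary.
Qed.

Lemma osc_unchart_elementary : elementary_map osc_unchart.
Proof.
apply: osc_map_elementary => [||j|j].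
- exact: elem_t.
- apply: elementaryB.
    by apply: elementaryB => //; exact: elem_M.
  apply: elementary_sum => j; apply: elem_M.
  exact: elementaryM.
- have -> : (fun p => osc_x (osc_unchart p) j) = fun q =>
      cos (nu j * osc_t q) * osc_x q j - sin (nu j * osc_t q) * osc_y q j.
    by apply/funext => p; rewrite osc_x_row.
  apply: elementaryB; apply: elementaryM => //.
    exact/elementary_cos/elem_M.
  exact/elementary_sin/elem_M.
- have -> : (fun p => osc_y (osc_unchart p) j) = fun q =>
      cos (nu j * osc_t q) * osc_y q j + sin (nu j * osc_t q) * osc_x q j.
    by apply/funext => p; rewrite osc_y_row.
  apply: elementaryD; apply: elementaryM => //.
    exact/elementary_cos/elem_M.
  exact/elementary_sin/elem_M.
Qed.

Definition chart_dx p v j :=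
  cos (nu j * osc_t p) * osc_x v j + sin (nu j * osc_t p) * osc_y v j
  + nu j * osc_t v * chart_y p j.
Definition chart_dy p v j :=
  cos (nu j * osc_t p) * osc_y v j - sin (nu j * osc_t p) * osc_x v j
  - nu j * osc_t v * chart_x p j.

Let is_derive_lin (l : osc R n -> R) p v : linear l -> is_derive p v l (l v).
Proof.
move=> ll; have el := elementary_scalar_map (osc_linear_elementary ll).
apply: DeriveDef; first exact: elementary_map_derivable.
have [_ ->] := elementary_map_lin ll (osc_id_elementary R n).
by rewrite derive_id.
Qed.

Let is_derive_cs p v j :
  is_derive p v (fun q => cos (nu j * osc_t q)) (- sin (nu j * osc_t p) * (nu j * osc_t v)) /\
  is_derive p v (fun q => sin (nu j * osc_t q)) (cos (nu j * osc_t p) * (nu j * osc_t v)).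
Proof.
have dt := is_deriveZ (nu j) (is_derive_lin p v (@osc_tP R n)).
have ft : differentiable (fun q => nu j * osc_t q) p.
  apply: elementary_map_differentiable.
  exact/elementary_scalar_map/elem_M.
rewrite -![nu j * osc_t v]/(nu j *: osc_t v) -(is_derive_val dt).
by split; apply: (is_derive_comp1 v ft).
Qed.

Lemma chart_x_derive p v j :
  is_derive p v (fun q => chart_x q j) (chart_dx p v j).
Proof.
have [dc ds] := is_derive_cs p v j.
have dx := is_derive_lin p v (@osc_xP R n j).
have dy := is_derive_lin p v (@osc_yP R n j).
have := is_deriveD (is_deriveM dc dx) (is_deriveM ds dy).
move=> /is_derive_eq; apply; rewrite /chart_dx /chart_y -![_ *: _]/(_ * _).
by ring.
Qed.

Lemma chart_y_derive p v j :
  is_derive p v (fun q => chart_y q j) (chart_dy p v j).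
Proof.
have [dc ds] := is_derive_cs p v j.
have dx := is_derive_lin p v (@osc_xP R n j).
have dy := is_derive_lin p v (@osc_yP R n j).
have := is_deriveB (is_deriveM dc dy) (is_deriveM ds dx).
move=> /is_derive_eq; apply; rewrite /chart_dy /chart_x -![_ *: _]/(_ * _).
by ring.
Qed.

Lemma osc_chart_derive p v : 'D_v osc_chart p = osc_row (osc_t v)
  (osc_s v + k * osc_t v
   + \sum_j c j * (chart_dx p v j * chart_y p j + chart_x p j * chart_dy p v j))
  (chart_dx p v) (chart_dy p v).
Proof.
have [E1 E2 E3 E4] := osc_coord_derive p v osc_chart_elementary.
apply: osc_coord_eq => [||j|j].
- rewrite E1; exact: (is_derive_val (is_derive_lin p v (@osc_tP R n))).
- rewrite E2 osc_s_row.
  have dxy j : is_derive p v (fun q => c j * (chart_x q j * chart_y q j))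
     (c j * (chart_dx p v j * chart_y p j + chart_x p j * chart_dy p v j)).
    have := is_deriveZ (c j) (is_deriveM (chart_x_derive p v j) (chart_y_derive p v j)).
    move=> /is_derive_eq; apply; rewrite -![_ *: _]/(_ * _); ring.
  have := is_deriveD (is_deriveD (is_derive_lin p v (@osc_sP R n))
    (is_deriveZ k (is_derive_lin p v (@osc_tP R n)))) (is_derive_sum dxy).
  move=> /is_derive_val <-; congr ('D_v _ p).
  by apply/funext => q; rewrite !fctE /= fct_sumE.
- rewrite E3 osc_x_row.
  have -> : (fun q => osc_x (osc_chart q) j) = fun q => chart_x q j.
    by apply/funext => q; rewrite osc_x_row.
  exact: (is_derive_val (chart_x_derive p v j)).
- rewrite E4 osc_y_row.
  have -> : (fun q => osc_y (osc_chart q) j) = fun q => chart_y q j.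
    by apply/funext => q; rewrite osc_y_row.
  exact: (is_derive_val (chart_y_derive p v j)).
Qed.

Lemma osc_chart0 : osc_chart 0 = 0.
Proof.
have E j : chart_x 0 j = 0 /\ chart_y 0 j = 0.
  by rewrite /chart_x /chart_y !osc_simp !mulr0 addr0 subr0.
apply: osc_coord_eq => [//||j|j].
- rewrite osc_s_row big1 => [|j _]; first by rewrite !osc_simp; ring.
  by have [-> ->] := E j; rewrite !mulr0.
- by rewrite osc_x_row (E j).1 !osc_simp.
- by rewrite osc_y_row (E j).2 !osc_simp.
Qed.

End OscChart.

(** * Left translations and composition of isometries *)

Section LeftTranslation.
Context (R : realType) (n : nat) (lam : 'I_n -> R).
Implicit Types (p q v w : osc R n).

Lemma osc_mul_elementary p : elementary_map (osc_mul lam p).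
Proof.
(* Left translations are affine in these coordinates, with [osc_dmul lam p] as linear part. *)
have -> : osc_mul lam p = fun q => p + osc_dmul lam p q.
  apply/funext => q; apply: osc_eqP => [//||j].
    by rewrite osc_s_mul -addrA.
  by rewrite osc_z_mul osc_zD osc_z_mk.
apply: elementary_mapD; first exact: elementary_map_cst.
exact: (elementary_map_lin (osc_dmul_linear lam p) (osc_id_elementary R n)).1.
Qed.

Lemma osc_mul_isometry u p : is_isometry (kmetric lam u) (osc_mul lam p).
Proof.
have sm q := elementary_map_smooth (osc_mul_elementary q).
split=> //.
  exists (osc_mul lam (osc_inv lam p)); split=> // q.
    by rewrite osc_mulA osc_mulVp osc_mul0p.
  by rewrite osc_mulA osc_mulpV osc_mul0p.
by move=> q v w; exact: kmetric_left_invariant.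
Qed.

End LeftTranslation.

Lemma isometry_comp (R : realType) (V : normedModType R)
    (g : V -> V -> V -> R) (f1 f2 : V -> V) :
  elementary_map f1 -> elementary_map f2 ->
  (exists h1, [/\ elementary_map h1, cancel f1 h1 & cancel h1 f1]) ->
  (exists h2, [/\ elementary_map h2, cancel f2 h2 & cancel h2 f2]) ->
  is_isometry g f1 -> is_isometry g f2 -> is_isometry g (fun p => f1 (f2 p)).
Proof.
move=> e1 e2 [h1 [k1 fh1 hf1]] [h2 [k2 fh2 hf2]] [_ _ I1] [_ _ I2].
have e12 := elementary_map_comp e1 e2.
split; first exact: elementary_map_smooth.
  exists (fun p => h2 (h1 p)); split.
  - exact/elementary_map_smooth/elementary_map_comp.
  - by move=> p; rewrite fh1 fh2.
  - by move=> p; rewrite hf2 hf1.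
have E p x : 'd (fun p => f1 (f2 p)) p x = 'd f1 (f2 p) ('d f2 p x).
  rewrite (elementary_map_diff p x e12) (elementary_map_chain p x e1 e2).
  by rewrite (elementary_map_diff p x e2) (elementary_map_diff _ _ e1).
move=> p v w.
exact: (etrans (congr2 (g _) (E p v) (E p w)) (etrans (I1 _ _ _) (I2 _ _ _))).
Qed.

(** * The endomorphism u and the metric in the left-invariant frame *)

Section KMetric.
Context (R : realType) (n : nat) (lam : 'I_n -> R).
Context (u : {linear osc R n -> osc R n}) (eta etac : 'I_n -> R).
Hypothesis lam_gt0 : forall i, 0 < lam i.
Hypothesis u_bij : bijective u.
Hypothesis u_sym : kform_symmetric lam u.
Hypothesis u_e0 : u (osc_e0 R n) = osc_e0 R n.
Hypothesis u_e : forall i, u (osc_e R i) = eta i *: osc_e R i.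
Hypothesis u_ec : forall i, u (osc_ec R i) = etac i *: osc_ec R i.
Implicit Types (p q v w : osc R n).

Let kform_e v i : kform lam v (osc_e R i) = (lam i)^-1 * osc_x v i.
Proof.
rewrite /kform (bigD1 i) //= big1 => [|j ji].
  by rewrite !osc_xy_e eqxx /osc_t /osc_s /=; ring.
by rewrite !osc_xy_e (negbTE ji) /=; ring.
Qed.

Let kform_ec v i : kform lam v (osc_ec R i) = (lam i)^-1 * osc_y v i.
Proof.
rewrite /kform (bigD1 i) //= big1 => [|j ji].
  by rewrite !osc_xy_e eqxx /osc_t /osc_s /=; ring.
by rewrite !osc_xy_e (negbTE ji) /=; ring.
Qed.

Let kform_e0 v : kform lam v (osc_e0 R n) = osc_t v.
Proof.
rewrite /kform big1 => [|j _]; first by rewrite !osc_simp; ring.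
by rewrite !osc_simp; ring.
Qed.

Let kformZ a v w : kform lam v (a *: w) = a * kform lam v w.
Proof.
rewrite /kform !mulrDr mulr_sumr !osc_simp; congr (_ + _ + _); try ring.
by apply: eq_bigr => j _; rewrite !osc_simp; ring.
Qed.

Let lam0 i : lam i != 0. Proof. exact: lt0r_neq0. Qed.

(** Symmetry of [u] is tested against its eigenvectors: [osc_em1] is orthogonal to every [osc_e] and
    [osc_ec], hence so is its image. Only the component along [osc_e0], the alpha of the chart,
    remains free. *)
Lemma u_em1_coord : [/\ osc_t (u (osc_em1 R n)) = 1,
  forall i, osc_x (u (osc_em1 R n)) i = 0 &
  forall i, osc_y (u (osc_em1 R n)) i = 0].
Proof.
split=> [|i|i].
- by rewrite -kform_e0 u_sym u_e0 kform_e0.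
- have := u_sym (osc_em1 R n) (osc_e R i).
  rewrite u_e kformZ !kform_e [osc_x (osc_em1 R n) i]mxE !mulr0 => /eqP.
  by rewrite mulf_eq0 invr_eq0 (negbTE (lam0 i)) => /eqP.
- have := u_sym (osc_em1 R n) (osc_ec R i).
  rewrite u_ec kformZ !kform_ec [osc_y (osc_em1 R n) i]mxE !mulr0 => /eqP.
  by rewrite mulf_eq0 invr_eq0 (negbTE (lam0 i)) => /eqP.
Qed.

Lemma u_coord v : u v = osc_row (osc_t v)
  (osc_s (u (osc_em1 R n)) * osc_t v + osc_s v)
  (fun j => eta j * osc_x v j) (fun j => etac j * osc_y v j).
Proof.
have [ut ux uy] := u_em1_coord.
pose r := osc_row 0 0 (fun j => eta j * osc_x v j) (fun j => etac j * osc_y v j).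
have -> : u v = osc_t v *: u (osc_em1 R n) + osc_s v *: osc_e0 R n + r.
  rewrite {1}(osc_basis_sum v) !linearD !linear_sum !linearZ /= u_e0 -addrA.
  congr (_ + _); rewrite (osc_basis_sum r) /r osc_t_row osc_s_row.
  rewrite !scale0r !add0r; congr (_ + _); apply: eq_bigr => j _.
    by rewrite linearZ /= u_e scalerA osc_x_row mulrC.
  by rewrite linearZ /= u_ec scalerA osc_y_row mulrC.
apply: osc_coord_eq => [||j|j]; rewrite /r.
- by rewrite !osc_tD !osc_tZ ut osc_t_row !osc_simp; ring.
- by rewrite !osc_sD !osc_sZ osc_s_row !osc_simp; ring.
- by rewrite !osc_xD !osc_xZ ux !osc_simp; ring.
- by rewrite !osc_yD !osc_yZ uy !osc_simp; ring.
Qed.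

Lemma eta_neq0 i : eta i != 0.
Proof.
apply/eqP => e0; have := u_e i; rewrite e0 scale0r -(linear0 u).
move=> /(bij_inj u_bij)/(congr1 (fun v => osc_x v i)).
by rewrite osc_xy_e eqxx [osc_x 0 i]mxE => /eqP; rewrite oner_eq0.
Qed.

Lemma etac_neq0 i : etac i != 0.
Proof.
apply/eqP => e0; have := u_ec i; rewrite e0 scale0r -(linear0 u).
move=> /(bij_inj u_bij)/(congr1 (fun v => osc_y v i)).
by rewrite osc_xy_e eqxx [osc_y 0 i]mxE => /eqP; rewrite oner_eq0.
Qed.

(* The components of the Maurer-Cartan form at p, applied to v. *)
Definition body_x p v j :=
  cos (lam j * osc_t p) * osc_x v j + sin (lam j * osc_t p) * osc_y v j.
Definition body_y p v j :=
  cos (lam j * osc_t p) * osc_y v j - sin (lam j * osc_t p) * osc_x v j.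
Definition body_s p v :=
  osc_s v - 2^-1 * \sum_j (osc_x p j * osc_y v j - osc_y p j * osc_x v j).

Lemma osc_dmul_inv p v :
  osc_dmul lam (osc_inv lam p) v =
  osc_row (osc_t v) (body_s p v) (body_x p v) (body_y p v).
Proof.
have zE j : osc_z (osc_dmul lam (osc_inv lam p) v) j =
    Complex (body_x p v j) (body_y p v j).
  rewrite osc_z_mk -[osc_t (osc_inv lam p)]/(- osc_t p) mulNr.
  rewrite /expi cosN sinN /osc_z /body_x /body_y (mulrC (lam j)).
  by apply/eqP; rewrite eq_complex /=; apply/andP; split; apply/eqP; ring.
apply: osc_coord_eq => [//||j|j].
- rewrite osc_s_row /body_s -[LHS]/(osc_s v + 2^-1 * _) -mulrN -sumrN.
  congr (_ + _ * _); apply: eq_bigr => j _.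
  rewrite osc_z_mk -[osc_t (osc_inv lam p)]/(- osc_t p) mulNr.
  rewrite /expi cosN sinN /osc_z /=.
  have := cos2Dsin2 (osc_t p * lam j).
  set C := cos (osc_t p * _); set S := sin (osc_t p * _) => h.
  have {}h : S ^+ 2 = 1 - C ^+ 2 by rewrite -h; ring.
  by ring: h.
- by rewrite osc_x_row; have := congr1 (@complex.Re R) (zE j).
- by rewrite osc_y_row; have := congr1 (@complex.Im R) (zE j).
Qed.

End KMetric.

(** * Rotation invariance of the area form and of the scalar product in the plane *)

Section Rotation.
Context (R : realType) (th x y a b : R).
Local Notation C := (cos th).
Local Notation S := (sin th).

Lemma rotation_det :
  (C * x + S * y) * (C * b - S * a) - (C * y - S * x) * (C * a + S * b) =
  x * b - y * a.
Proof.
have h : S ^+ 2 = 1 - C ^+ 2 by rewrite -(cos2Dsin2 th); ring.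
by ring: h.
Qed.

Lemma rotation_dot :
  (C * x + S * y) * (C * a + S * b) + (C * y - S * x) * (C * b - S * a) =
  x * a + y * b.
Proof.
have h : S ^+ 2 = 1 - C ^+ 2 by rewrite -(cos2Dsin2 th); ring.
by ring: h.
Qed.

End Rotation.

(** * Identification of k_u with a plane wave *)

Section KWave.
Context (R : realType) (n : nat) (lam : 'I_n -> R).
Context (u : {linear osc R n -> osc R n}) (eta etac : 'I_n -> R).
Hypothesis lam_gt0 : forall i, 0 < lam i.
Hypothesis u_bij : bijective u.
Hypothesis u_sym : kform_symmetric lam u.
Hypothesis u_e0 : u (osc_e0 R n) = osc_e0 R n.
Hypothesis u_e : forall i, u (osc_e R i) = eta i *: osc_e R i.
Hypothesis u_ec : forall i, u (osc_ec R i) = etac i *: osc_ec R i.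
Hypothesis eta_etac : forall i, eta i + etac i = 1 \/ eta i = etac i.
Implicit Types (p q v w : osc R n).

(* nu_j and c_j are determined by the absence of terms in
   dt (x_j dy_j - y_j dx_j) and dt (x_j dy_j + y_j dx_j). *)
Definition k_freq j :=
  if eta j + etac j == 1 then lam j else lam j / (2 * eta j).
Definition k_shear j :=
  if eta j + etac j == 1 then (1 - 2 * eta j) / 2 else 0.
Definition k_chart :=
  osc_chart k_freq k_shear (osc_s (u (osc_em1 R n)) / 2).
Definition k_unchart :=
  osc_unchart k_freq k_shear (osc_s (u (osc_em1 R n)) / 2).

Lemma eta_div_lam_neq0 j : eta j / lam j != 0.
Proof.
by rewrite mulf_neq0 ?invr_eq0 ?(lt0r_neq0 (lam_gt0 j)) // (eta_neq0 u_bij u_e).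
Qed.

Lemma etac_div_lam_neq0 j : etac j / lam j != 0.
Proof.
by rewrite mulf_neq0 ?invr_eq0 ?(lt0r_neq0 (lam_gt0 j)) // (etac_neq0 u_bij u_ec).
Qed.

Lemma k_freq_neq0 j : k_freq j != 0.
Proof.
have l0 := lt0r_neq0 (lam_gt0 j); rewrite /k_freq; case: ifP => // _.
by rewrite mulf_neq0 // invr_eq0 mulf_neq0 ?pnatr_eq0 // (eta_neq0 u_bij u_e).
Qed.

Definition k_wave := osc_wave_data k_freq eta_div_lam_neq0 etac_div_lam_neq0.

(** Both metrics are a common part without index plus a sum over j, so they can be compared for each
    j separately, where (a) or (b) is available. *)
Lemma kmetric_term p v w j :
  - 2^-1 * (osc_t v * (osc_x p j * osc_y w j - osc_y p j * osc_x w j)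
            + osc_t w * (osc_x p j * osc_y v j - osc_y p j * osc_x v j))
  + (lam j)^-1 * (eta j * body_x lam p v j * body_x lam p w j
                  + etac j * body_y lam p v j * body_y lam p w j) =
  k_shear j *
    (osc_t v * (chart_dx k_freq p w j * chart_y k_freq p j
                + chart_x k_freq p j * chart_dy k_freq p w j)
     + osc_t w * (chart_dx k_freq p v j * chart_y k_freq p j
                  + chart_x k_freq p j * chart_dy k_freq p v j))
  + (eta j / lam j * (chart_dx k_freq p v j * chart_dx k_freq p w j)
     + etac j / lam j * (chart_dy k_freq p v j * chart_dy k_freq p w j))
  - k_freq j ^+ 2 * (eta j / lam j * chart_x k_freq p j ^+ 2
                     + etac j / lam j * chart_y k_freq p j ^+ 2)
    * (osc_t v * osc_t w).
Proof.
set dx := chart_dx k_freq p; set dy := chart_dy k_freq p.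
set zx := chart_x k_freq p j; set zy := chart_y k_freq p j.
have l0 := lt0r_neq0 (lam_gt0 j).
have e0 := eta_neq0 u_bij u_e j.
(* The area form may be evaluated in rotated coordinates. The added multiples of
   [k_freq j * osc_t q] remove from [dx] and [dy] what comes from the moving angle. *)
have det q : osc_x p j * osc_y q j - osc_y p j * osc_x q j =
    zx * (dy q j + k_freq j * osc_t q * zx)
    - zy * (dx q j - k_freq j * osc_t q * zy).
  rewrite -(rotation_det (k_freq j * osc_t p)) /dx /dy /chart_dx /chart_dy.
  by rewrite -/zx -/zy; congr (_ * _ - _ * _); ring.
rewrite !{}det.
have bodyE : (lam j)^-1 * (eta j * body_x lam p v j * body_x lam p w j
                  + etac j * body_y lam p v j * body_y lam p w j) =
    (lam j)^-1 * (eta j * (dx v j - k_freq j * osc_t v * zy)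
                        * (dx w j - k_freq j * osc_t w * zy)
                + etac j * (dy v j + k_freq j * osc_t v * zx)
                         * (dy w j + k_freq j * osc_t w * zx)).
  have dxE q : dx q j - k_freq j * osc_t q * zy =
      cos (k_freq j * osc_t p) * osc_x q j + sin (k_freq j * osc_t p) * osc_y q j.
    by rewrite /dx /chart_dx addrK.
  have dyE q : dy q j + k_freq j * osc_t q * zx =
      cos (k_freq j * osc_t p) * osc_y q j - sin (k_freq j * osc_t p) * osc_x q j.
    by rewrite /dy /chart_dy subrK.
  rewrite !dxE !dyE; congr (_ * _).
  (* In case (a) both sides use the angle [lam j * osc_t p]. In case (b) the angles differ, but with
     equal eigenvalues the form is a multiple of the scalar product, which no rotation changes. *)
  rewrite /k_freq; case: eqP => [//|h].
  have [//|<-] := eta_etac j.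
  by rewrite -!mulrA -!mulrDr rotation_dot rotation_dot.
rewrite {}bodyE; move: (dx v j) (dx w j) (dy v j) (dy w j) @zx @zy.
move: (osc_t v) (osc_t w) => tv tw av aw bv bw zx zy.
(* All trigonometric functions are now hidden in free variables; what is left is a rational identity
   in [eta j] and [lam j]. *)
rewrite /k_shear /k_freq; case: eqP => [h|h].
  have -> : etac j = 1 - eta j by rewrite -h; ring.
  by field.
have [//|<-] := eta_etac j.
by field; rewrite e0 l0.
Qed.

Lemma kmetric_wave p v w :
  kmetric lam u p v w =
  wave_metric k_wave (k_chart p) ('D_v k_chart p) ('D_w k_chart p).
Proof.
rewrite kmetricE !osc_dmul_inv !osc_chart_derive (u_coord lam_gt0 u_sym u_e0 u_e u_ec).
set al := osc_s (u _).
rewrite /wave_metric /k_wave /=.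
(* The part without index j, polar form of 2 dt ds + alpha dt^2. On the plane wave side alpha comes
   from the two halves contributed by the shift of s in the two arguments. *)
pose m := osc_t v * osc_s w + osc_s v * osc_t w + al * osc_t v * osc_t w.
transitivity (m + \sum_j (- 2^-1 *
   (osc_t v * (osc_x p j * osc_y w j - osc_y p j * osc_x w j)
            + osc_t w * (osc_x p j * osc_y v j - osc_y p j * osc_x v j))
  + (lam j)^-1 * (eta j * body_x lam p v j * body_x lam p w j
                  + etac j * body_y lam p v j * body_y lam p w j))).
  rewrite /kform !(osc_t_row, osc_s_row).
  under eq_bigr => j _ do rewrite !(osc_x_row, osc_y_row).
  rewrite big_split -mulr_sumr big_split -!mulr_sumr /body_s /m /=.
  by ring.
rewrite (eq_bigr _ (fun j _ => kmetric_term p v w j)) /=.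
set q := k_chart p; set q1 := osc_row _ _ _ _; set q2 := osc_row _ _ _ _.
pose X w0 j := k_shear j * (chart_dx k_freq p w0 j * chart_y k_freq p j
                            + chart_x k_freq p j * chart_dy k_freq p w0 j).
rewrite [RHS](_ : _ = m + (osc_t v * (\sum_j X w j) + osc_t w * (\sum_j X v j)
    + osc_form (fun j => eta j / lam j) (fun j => etac j / lam j) q1 q2
    - osc_form (fun j => eta j / lam j) (fun j => etac j / lam j)
        (osc_op k_freq q) q * (osc_t v * osc_t w))); last first.
  by rewrite /q1 /q2 !(osc_t_row, osc_s_row) /m /X -/al; field.
congr (_ + _); rewrite /osc_form !mulr_sumr mulr_suml -!big_split -sumrB.
apply: eq_bigr => j _; rewrite /X /osc_op /q1 /q2 /q /k_chart /osc_chart.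
by rewrite /= !(osc_x_row, osc_y_row); ring.
Qed.

End KWave.

(** * Local symmetry, completeness and global symmetries of k_u *)

Theorem mainTheorem4 (R : realType) (n : nat) (hn : (0 < n)%N)
    (lam : 'I_n -> R)
    (lam_gt0 : forall i, 0 < lam i)
    (lam_le : forall i j : 'I_n, (i <= j)%N -> lam i <= lam j)
    (u : {linear osc R n -> osc R n})
    (u_bij : bijective u)
    (u_sym : kform_symmetric lam u)
    (u_e0 : u (osc_e0 R n) = osc_e0 R n)
    (eta etac : 'I_n -> R)
    (u_e : forall i, u (osc_e R i) = eta i *: osc_e R i)
    (u_ec : forall i, u (osc_ec R i) = etac i *: osc_ec R i)
    (eta_etac : forall i, eta i + etac i = 1 \/ eta i = etac i) :
  [/\ locally_symmetric (kmetric lam u),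
      geodesically_complete (kmetric lam u) &
      symmetric_space (kmetric lam u)].
Proof.
pose Phi := k_chart lam u eta etac; pose F := k_unchart lam u eta etac.
pose D := k_wave lam_gt0 u_bij u_e u_ec.
have P0 : elementary_map Phi := osc_chart_elementary _ _ _.
have F0 : elementary_map F := osc_unchart_elementary _ _ _.
have PK : cancel Phi F := osc_chartK _ _ _.
have FK : cancel F Phi := osc_unchartK _ _ _.
have gE : forall p v w, kmetric lam u p v w =
    wave_metric D (Phi p) ('D_v Phi p) ('D_w Phi p).
  by move=> p v w; exact: kmetric_wave.
have Phi0 : Phi 0 = 0 := osc_chart0 _ _ _.
split.
- exact: (wave_pullback_locally_symmetric P0 F0 PK FK gE (osc_id_elementary R n)).
- apply: (wave_pullback_complete P0 F0 PK FK gE) => b z0 z1 b0 t0 s0 t1 s1.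
  have nu0 := k_freq_neq0 etac lam_gt0 u_bij u_e.
  have [Z [Z1 [eZ dZ dZ1 tZ Z0]]] := osc_oscillator nu0 b0 t0 s0 t1 s1.
  by exists Z, Z1; split.
- split; first exact: (wave_pullback_pseudo_riemannian P0 F0 PK FK gE).
  move=> p; pose r := wave_reflection Phi F.
  have er : elementary_map r by exact: wave_reflection_elementary.
  have ep q := osc_mul_elementary lam q.
  have rr : cancel r r by move=> q; rewrite /r /wave_reflection FK opprK PK.
  have LK q : cancel (osc_mul lam q) (osc_mul lam (osc_inv lam q)).
    by move=> x; rewrite osc_mulA osc_mulVp osc_mul0p.
  have KL q : cancel (osc_mul lam (osc_inv lam q)) (osc_mul lam q).
    by move=> x; rewrite osc_mulA osc_mulpV osc_mul0p.
  have [r0 dr0] := wave_reflection_fix P0 F0 PK FK Phi0.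
  pose s q := r (osc_mul lam (osc_inv lam p) q).
  have es : elementary_map s by exact: (elementary_map_comp er).
  have eps := elementary_map_comp (ep p) es.
  have s0 : s p = 0 by rewrite /s osc_mulVp.
  exists (fun q => osc_mul lam p (s q)); split.
  + apply: (isometry_comp (ep p) es).
    * by exists (osc_mul lam (osc_inv lam p)); split.
    * exists (fun q => osc_mul lam p (r q)); split.
      - exact: elementary_map_comp.
      - by move=> q; rewrite /s rr KL.
      - by move=> q; rewrite /s LK rr.
    * exact: osc_mul_isometry.
    * apply: (isometry_comp er (ep _)).
      - by exists r; split.
      - by exists (osc_mul lam p); split.
      - exact: (wave_reflection_isometry P0 F0 PK FK gE).
      - exact: osc_mul_isometry.
  + by rewrite s0 osc_mulp0.
  + move=> v; rewrite (elementary_map_diff p v eps).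
    rewrite (elementary_map_chain p v (ep p) es) s0.
    (* At the unit the reflection has differential - id, which commutes with the differentials of
       the two mutually inverse translations around it. *)
    have -> : 'D_v s p = - 'D_v (osc_mul lam (osc_inv lam p)) p.
      rewrite (elementary_map_chain p v er (ep _)) osc_mulVp; exact: dr0.
    have := derive_cancel (ep _) (ep p) (KL p) p v; rewrite osc_mulVp => E.
    exact: (etrans (derive_opp _ _ (ep p)) (congr1 -%R E)).
Qed.
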